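(* Let $f:\mathbb S\to[0,\infty)$. The following statements are equivalent: (i) $f\in C^2(\mathbb S)$ and $Q(f)=0$. (ii) $f\in C^1(\mathbb S)$ and $\mathcal D(f)=0$. (iii) There exist $\rho\ge0$ and $\Omega\in\mathbb S$ such that $f=\rho M_{\kappa\Omega}$, where $\kappa\ge 0$ satisfies the compatibility equation $j(\kappa)=\rho\,c(\kappa)$.
   Context: Let $n\ge 2$ and let $\mathbb S$ be the unit sphere of $\mathbb R^n$ with the uniform probability measure $d\omega$. $\nabla_\omega$, $\nabla_\omega\cdot$, $\Delta_\omega$ are the gradient, divergence and Laplace–Beltrami operator on $\mathbb S$; $P_{\omega^\perp}=\mathrm{Id}-\omega\otimes\omega$. The functions $\nu:[0,\infty)\to[0,\infty)$ and $\tau:[0,\infty)\to(0,\infty)$ are such that $r\mapsto\nu(r)/r$ and $r\mapsto\tau(r)$ are Lipschitz and bounded; $\tau_0=\tau(0)>0$. The function $k(r)=\nu(r)/\tau(r)$ is increasing; $\kappa_{max}=\lim_{r\to\infty}k(r)$ and $j:[0,\kappa_{max})\to[0,\infty)$ is the inverse function of $k$. For $f$ on $\mathbb S$, $J_f=\int_{\mathbb S}\omega f\,d\omega$, $\Omega_f=J_f/|J_f|$, $$Q(f)=-\nu(|J_f|)\nabla_\omega\cdot(P_{\omega^\perp}\Omega_f\,f)+\tau(|J_f|)\Delta_\omega f$$ (with $Q(f)=\tau_0\Delta_\omega f$ if $J_f=0$), and $$\mathcal D(f)=\tau(|J_f|)\int_{\mathbb S}f\,|\nabla_\omega(\ln f-k(|J_f|)\,\omega\cdot\Omega_f)|^2\,d\omega,$$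 where the integrand is understood to vanish where $f=0$, and $k(|J_f|)\,\omega\cdot\Omega_f$ is $0$ if $J_f=0$. $M_{\kappa\Omega}(\omega)=e^{\kappa\,\omega\cdot\Omega}/\int_{\mathbb S}e^{\kappa\,\upsilon\cdot\Omega}d\upsilon$ for $\kappa\ge0$, $\Omega\in\mathbb S$, and $c(\kappa)=\frac{\int_0^\pi\cos\theta\,e^{\kappa\cos\theta}\sin^{n-2}\theta\,d\theta}{\int_0^\pi e^{\kappa\cos\theta}\sin^{n-2}\theta\,d\theta}$, so that $J_{M_{\kappa\Omega}}=c(\kappa)\Omega$. *)

(* Defs.v *)
From HB Require Import structures.
From mathcomp Require Import all_boot all_order all_algebra.
From mathcomp Require Import all_classical all_reals all_analysis.
From mathcomp Require Import measurable_realfun.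
Import Order.TTheory GRing.Theory Num.Theory.
Import numFieldNormedType.Exports.

Set Implicit Arguments.
Unset Strict Implicit.
Unset Printing Implicit Defensive.

Local Open Scope classical_set_scope.
Local Open Scope ring_scope.

(* The library norm on 'rV[R]_n is the max norm, hence [enorm]. *)
Definition dot (R : realType) (n : nat) (x y : 'rV[R]_n) : R :=
  \sum_i x 0 i * y 0 i.

Definition enorm (R : realType) (n : nat) (x : 'rV[R]_n) : R :=
  Num.sqrt (dot x x).

Definition sphere (R : realType) (n : nat) : set 'rV[R]_n :=
  [set x | enorm x = 1].

(* x / |x|; equal to 0 at x = 0 since 0^-1 = 0. *)
Definition direction (R : realType) (n : nat) (x : 'rV[R]_n) : 'rV[R]_n :=
  (enorm x)^-1 *: x.

Section lebesgue_cons.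
Local Open Scope ereal_scope.
Context (R : realType) (n : nat).
Let T := measurableTypeR R.
Variable m : {sigma_finite_measure set (n.-tuple T) -> \bar R}.

Let consT (p : T * n.-tuple T) : n.+1.-tuple T := [tuple of p.1 :: p.2].

Let mconsT : measurable_fun [set: T * n.-tuple T] consT.
Proof. exact: (measurable_cons measurable_fst measurable_snd). Qed.

Definition lebesgue_cons : set (n.+1.-tuple T) -> \bar R :=
  pushforward (@lebesgue_measure R \x m) consT.

Let lebesgue_cons0 : lebesgue_cons set0 = 0.
Proof. by rewrite /lebesgue_cons /pushforward preimage_set0 measure0. Qed.

Let lebesgue_cons_ge0 A : 0 <= lebesgue_cons A.
Proof. exact: measure_ge0. Qed.

Let lebesgue_cons_sigma_additive : semi_sigma_additive lebesgue_cons.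
Proof.
move=> F mF tF mUF; rewrite /lebesgue_cons /pushforward preimage_bigcup.
apply: measure_semi_sigma_additive.
- by move=> k; rewrite -[X in measurable X]setTI; exact: mconsT.
- apply/trivIsetP => /= i j _ _ ij; rewrite -preimage_setI.
  by move/trivIsetP : tF => /(_ _ _ _ _ ij) ->//; rewrite preimage_set0.
- by rewrite -preimage_bigcup -[X in measurable X]setTI; exact: mconsT.
Qed.

HB.instance Definition _ := isMeasure.Build _ _ _ lebesgue_cons
  lebesgue_cons0 lebesgue_cons_ge0 lebesgue_cons_sigma_additive.

Let lebesgue_cons_sigma_finite : sigma_finite setT lebesgue_cons.
Proof.
have /sigma_finiteP[F [FT ndF Foo]] := sigma_finiteT (@lebesgue_measure R).
have /sigma_finiteP[G [GT ndG Goo]] := sigma_finiteT m.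
pose g (t : n.+1.-tuple T) : T * n.-tuple T := (thead t, [tuple of behead t]).
have mg : measurable_fun setT g.
  apply: measurable_fun_pair; last exact: measurable_behead.
  exact: measurable_tnth.
have gK p : g (consT p) = p.
  case: p => x t; rewrite /g /consT /thead tnth0/=; congr pair.
  exact: val_inj.
exists (fun k => g @^-1` (F k `*` G k)).
  apply/seteqP; split=> // t _.
  have [k _ Fk] : (\bigcup_k F k) (thead t) by rewrite -FT.
  have [l _ Gl] : (\bigcup_k G k) [tuple of behead t] by rewrite -GT.
  exists (maxn k l) => //; split=> /=.
    by move: Fk; exact/subsetPset/ndF/leq_maxl.
  by move: Gl; exact/subsetPset/ndG/leq_maxr.
move=> k; have [mF Fk] := Foo k; have [mG Gk] := Goo k.
have mFG : measurable (F k `*` G k) by exact: measurableX.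
split; first by rewrite -[X in measurable X]setTI; exact: mg.
rewrite /lebesgue_cons /pushforward -comp_preimage.
rewrite (_ : g \o consT = id); last exact/funext.
by rewrite preimage_id product_measure1E// lte_mul_pinfty// ge0_fin_numE.
Qed.

HB.instance Definition _ := Measure_isSigmaFinite.Build _ _ _ lebesgue_cons
  lebesgue_cons_sigma_finite.

End lebesgue_cons.

(* n-dimensional Lebesgue measure, as an iterated product measure. *)
Fixpoint lebesgue_tuple (R : realType) (n : nat) :
    {sigma_finite_measure set (n.-tuple (measurableTypeR R)) -> \bar R} :=
  match n with
  | 0 => dirac (R := R) ([tuple] : 0.-tuple (measurableTypeR R))
  | n'.+1 => lebesgue_cons (lebesgue_tuple R n')
  end.

Definition borel_rV (R : realType) (n : nat) :=
  g_sigma_algebraType (@open 'rV[R]_n).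

Definition row_of_tuple (R : realType) (n : nat)
    (t : n.-tuple (measurableTypeR R)) : borel_rV R n :=
  \row_i (tnth t i : R).

Definition unit_ball (R : realType) (n : nat) :
    set (n.-tuple (measurableTypeR R)) :=
  [set t | enorm (row_of_tuple t) <= 1].

(* A |-> Leb {x | |x| <= 1 and x / |x| \in A} *)
Definition cone_measure (R : realType) (n : nat) (A : set (borel_rV R n)) :
    \bar R :=
  lebesgue_tuple R n
    ([set t | A (direction (row_of_tuple t))] `&` @unit_ball R n).

Section sphere_measure.
Context (R : realType) (n : nat).
Let T := measurableTypeR R.
Let row_of : n.-tuple T -> borel_rV R n := @row_of_tuple R n.

Let measurable_row_of : measurable_fun setT row_of.
Proof.
apply: (@measurability _ _ _ _ setT row_of (@open 'rV[R]_n)) => //.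
move=> _ [U oU <-]; rewrite setTI.
pose box (qk : {ffun 'I_n -> rat} * nat) : set (n.-tuple T) :=
  \bigcap_(i in [set: 'I_n])
    ((fun t : n.-tuple T => tnth t i) @^-1`
       (ball (ratr (qk.1 i) : R) (qk.2.+1%:R^-1))).
pose good qk := box qk `<=` row_of @^-1` U.
rewrite (_ : _ @^-1` _ = \bigcup_qk (if `[< good qk >] then box qk else set0)).
  apply: countable_bigcupT_measurable => // qk; case: ifP => // _.
  apply: fin_bigcap_measurable; first exact: finite_finset.
  move=> i _; rewrite -[X in measurable X]setTI.
  apply: measurable_tnth => //; exact: measurable_ball.
apply/seteqP; split => [t Ut|t [qk _]]; last first.
  by case: asboolP => // qkU; exact: qkU.
have /nbhs_ballP[e /= e0 eU] : nbhs (row_of t : 'rV[R]_n) U.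
  exact: open_nbhs_nbhs.
have [k _ ke] : \forall k \near \oo, k.+1%:R^-1 < e / 2 :> R.
  exact: (near_infty_natSinv_lt (PosNum (divr_gt0 e0 (ltr0Sn R 1)))).
have {}ke := ke k (leqnn k).
have k0 : 0 < k.+1%:R^-1 :> R by rewrite invr_gt0 ltr0Sn.
have /choice[q qP] i : exists q : rat,
    ball (ratr q : R) (k.+1%:R^-1) (tnth t i : R).
  have [|q Hq] := @rat_in_itvoo R (tnth t i - k.+1%:R^-1) (tnth t i + k.+1%:R^-1).
    by rewrite ltrD2l gtrN.
  exists q; move: Hq; rewrite in_itv/= => qt.
  by rewrite /ball/= ltr_distl.
exists ([ffun i => q i], k) => //.
have boxt : box ([ffun i => q i], k) t by move=> i _ /=; rewrite ffunE.
case: asboolP => // -[] s boxs; apply: eU; split=> // i j.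
rewrite !mxE (splitr e).
apply: (@ball_triangle _ _ (ratr (q j) : R)).
  by apply: ball_sym; apply: le_ball (ltW ke) _ _; exact: qP.
by apply: le_ball (ltW ke) _ _; have := boxs j Logic.I; rewrite /= ffunE.
Qed.

Let to_sphere (t : n.-tuple T) : borel_rV R n := direction (row_of t).

Let measurable_enorm :
  measurable_fun setT (fun t : n.-tuple T => enorm (row_of t) : T).
Proof.
have msqrt : measurable_fun [set: R] (@Num.sqrt R).
  by apply: continuous_measurable_fun; exact: sqrt_continuous.
apply: (measurableT_comp msqrt).
apply: measurable_sum => i.
apply: (eq_measurable_fun (fun t : n.-tuple T => (tnth t i : R) * tnth t i)).
  by move=> t _; rewrite !mxE.
by apply: measurable_funM; exact: measurable_tnth.
Qed.

Let measurable_unit_ball : measurable (@unit_ball R n).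
Proof.
rewrite (_ : @unit_ball R n =
    (fun t => enorm (row_of t)) @^-1` [set` `]-oo, (1 : R)]]); last first.
  by apply/seteqP; split=> t /=; rewrite in_itv.
rewrite -[X in measurable X]setTI; apply: measurable_enorm => //.
Qed.

Let measurable_to_sphere : measurable_fun setT to_sphere.
Proof.
pose h (t : n.-tuple T) : n.-tuple T :=
  [tuple (enorm (row_of t)) `^ (-1) * (tnth t i : R) | i < n].
rewrite (_ : to_sphere = row_of \o h); last first.
  apply/funext => t; apply/rowP => i; rewrite !mxE tnth_mktuple.
  by rewrite powR_inv1// sqrtr_ge0.
apply: measurableT_comp; first exact: measurable_row_of.
apply/measurable_fun_tnthP => i.
apply: (eq_measurable_fun
    (fun t => (enorm (row_of t)) `^ (-1) * (tnth t i : R))).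
  by move=> t _; rewrite /= tnth_mktuple.
apply: measurable_funM; last exact: measurable_tnth.
exact: (measurableT_comp (measurable_powR (-1)) measurable_enorm).
Qed.

Let m := mrestr (lebesgue_tuple R n) measurable_unit_ball.

Let cone_measure0 : @cone_measure R n set0 = 0%E.
Proof. by rewrite /cone_measure set0I measure0. Qed.

Let cone_measure_ge0 A : (0 <= @cone_measure R n A)%E.
Proof. exact: measure_ge0. Qed.

Let cone_measure_sigma_additive : semi_sigma_additive (@cone_measure R n).
Proof.
move=> F mF tF mUF.
have mpre A : measurable A -> measurable (to_sphere @^-1` A).
  by move=> mA; rewrite -[X in measurable X]setTI; exact: measurable_to_sphere.
rewrite (_ : cone_measure _ = m (\bigcup_k (to_sphere @^-1` F k))); last first.
  by rewrite -preimage_bigcup.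
apply: (@measure_semi_sigma_additive _ _ _ m (fun k => to_sphere @^-1` F k)).
- by move=> k; exact: mpre.
- apply/trivIsetP => /= i j _ _ ij; rewrite -preimage_setI.
  by move/trivIsetP : tF => /(_ _ _ _ _ ij) ->//; rewrite preimage_set0.
- by rewrite -preimage_bigcup; exact: mpre.
Qed.

HB.instance Definition _ := isMeasure.Build _ _ _ (@cone_measure R n)
  cone_measure0 cone_measure_ge0 cone_measure_sigma_additive.

(* Normalized surface measure of the sphere, as a Borel probability measure on
   the ambient space. The unit ball has positive finite volume for n > 0, so the
   default value of [mnormalize] is not used. *)
Definition uniform_sphere : probability (borel_rV R n) R :=
  mnormalize (@cone_measure R n) (dirac (T := borel_rV R n) (R := R) (0 : 'rV[R]_n)).

End sphere_measure.

Fixpoint partials_Ck (R : realType) (n k : nat) (U : set 'rV[R]_n)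
    (F : 'rV[R]_n -> R) : Prop :=
  match k with
  | 0 => forall x, U x -> {for x, continuous F}
  | k'.+1 => forall i : 'I_n,
      (forall x, U x -> derivable F x (delta_mx 0 i)) /\
      partials_Ck k' U ('D_(delta_mx 0 i) F)
  end.

(* A function f on the sphere is given by any function on 'rV[R]_n, of which
   only the values on the sphere matter. It is studied through its extension
   f (x / |x|), homogeneous of degree 0: f is C^k on the sphere iff this
   extension is C^k away from 0, and the derivatives of the extension at a point
   of the sphere are the tangential derivatives of f, as its normal derivative
   vanishes. *)
Definition sphere_Ck (R : realType) (n k : nat) (f : 'rV[R]_n -> R) : Prop :=
  partials_Ck k [set x | x != 0] (f \o @direction R n).

Definition sphere_grad (R : realType) (n : nat) (f : 'rV[R]_n -> R)
    (w : 'rV[R]_n) : 'rV[R]_n :=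
  \row_i 'D_(delta_mx 0 i) (f \o @direction R n) w.

(* Meant for tangent vector fields A. *)
Definition sphere_div (R : realType) (n : nat) (A : 'rV[R]_n -> 'rV[R]_n)
    (w : 'rV[R]_n) : R :=
  \sum_i 'D_(delta_mx 0 i) (fun x => A (direction x) 0 i) w.

Definition sphere_laplacian (R : realType) (n : nat) (f : 'rV[R]_n -> R) :
    'rV[R]_n -> R :=
  sphere_div (sphere_grad f).

(* P_{w^perp} v for w on the sphere *)
Definition tangent_proj (R : realType) (n : nat) (w v : 'rV[R]_n) : 'rV[R]_n :=
  v - dot w v *: w.

Definition J (R : realType) (n : nat) (f : 'rV[R]_n -> R) : 'rV[R]_n :=
  \row_i \int[@uniform_sphere R n]_(w in @sphere R n) (w 0 i * f w).

Section kinetic.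
Context (R : realType) (n : nat) (nu tau : R -> R).
Implicit Types (f : 'rV[R]_n -> R) (w Omega : 'rV[R]_n).

Definition krate (r : R) : R := nu r / tau r.

(* When J f = 0, [direction (J f)] is 0, so that Q f = tau 0 *: Laplacian of f
   and the drift term k(|J f|) w . Omega_f of [dissipation] vanishes. *)
Definition Q f w : R :=
  - nu (enorm (J f)) *
      sphere_div (fun u => f u *: tangent_proj u (direction (J f))) w
  + tau (enorm (J f)) * sphere_laplacian f w.

(* The integrand is a product of real numbers, hence is 0 where f = 0. Its
   integral may be infinite for f of class C^1. *)
Definition dissipation f : \bar R :=
  ((tau (enorm (J f)))%:E *
   \int[@uniform_sphere R n]_(w in @sphere R n)
     (f w * enorm (sphere_grad
        (fun u => ln (f u) - krate (enorm (J f)) * dot u (direction (J f))) w)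
        ^+ 2)%:E)%E.

Definition von_mises (kappa : R) Omega w : R :=
  expR (kappa * dot w Omega) /
  \int[@uniform_sphere R n]_(u in @sphere R n) expR (kappa * dot u Omega).

(* [n - 2] is a natural number subtraction, used for n >= 2. *)
Definition order_c (kappa : R) : R :=
  (\int[@lebesgue_measure R]_(t in `[0, pi])
     (cos t * expR (kappa * cos t) * sin t ^+ (n - 2))) /
  (\int[@lebesgue_measure R]_(t in `[0, pi])
     (expR (kappa * cos t) * sin t ^+ (n - 2))).

End kinetic.

(* Main.v *)
(* For r = |J_f|, kappa = k(r) and t(w) = kappa w . Omega_f, put
   A = grad f - kappa f P_{w^perp} Omega_f = e^t grad (f e^-t). Then
   Q(f) = tau(r) div A and the density of D(f) is tau(r) |A|^2 / f. If Q(f) = 0,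
   testing div A = 0 against f e^-t gives int e^t |grad (f e^-t)|^2 = 0. If
   D(f) = 0, then A = 0 where f > 0, and A = 0 also where f = 0, because f is
   minimal there. Either way A = 0, so f e^-t is constant on the sphere, and
   (iii) only expresses that the flux of f = C e^t equals J_f.

   The integration by parts is obtained in the ambient space: for a tangent
   field A and a radial cutoff W, div (W A(x/|x|)) = W div (A(x/|x|)) integrates
   to 0 along lines, and the cutoffs tend to the indicator function of the ball
   that defines the measure on the sphere. Applied to (w . Omega)^k P_{w^perp} v
   it gives for the moments of w . Omega the recursion satisfied by
   int cos^k sin^(n-2); these moments determine int w e^{kappa w . Omega}. *)
Require Import Defs.
From mathcomp Require Import all_boot all_order all_algebra.
From mathcomp Require Import all_classical all_reals all_analysis.
From mathcomp Require Import measurable_realfun ring lra.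
Import Order.TTheory GRing.Theory Num.Theory.
Import numFieldNormedType.Exports.

Set Implicit Arguments.
Unset Strict Implicit.
Unset Printing Implicit Defensive.

Local Open Scope classical_set_scope.
Local Open Scope ring_scope.

(** * Directional derivatives *)

(** Regularity is expressed by continuous partial derivatives only. Hence chain rules are taken
    along lines, and a first-order expansion is rebuilt coordinate by coordinate; it gives the
    continuity of a C^1 function and the orthogonality w . grad f = 0, without which the field A
    would not be known to be tangent.

    The uniform measure is an image of Lebesgue measure on the ball, with neither charts nor a
    slicing of the sphere into parallels. This is why c(kappa) has to be reached through moments:
    those of w . Omega and those of the cosine both satisfy (n - 1 + k) a_(k+1) = k a_(k-1), so the
    two sequences are proportional, and the unknown factor cancels in the quotient that defines c.

    If J f = 0 the direction of the flux degenerates. The statements still agree because k(0) = 0,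
    which is deduced from 0 lying in the range of k; any unit vector can then serve as Omega.

    The step from (ii) to (i) has to produce a second derivative of f. It is obtained by passing
    through the explicit form (iii), which is smooth. *)

Section dot_product.
Context (R : realType) (n : nat).
Implicit Types (x y w : 'rV[R]_n) (a : R).

Lemma dotC x y : dot x y = dot y x.
Proof. by apply: eq_bigr => i _; rewrite mulrC. Qed.

Lemma dotDl x y w : dot (x + y) w = dot x w + dot y w.
Proof. by rewrite -big_split; apply: eq_bigr => i _; rewrite mxE mulrDl. Qed.

Lemma dotZl a x w : dot (a *: x) w = a * dot x w.
Proof. by rewrite big_distrr; apply: eq_bigr => i _; rewrite mxE /= mulrA. Qed.

Lemma dotDr x y w : dot w (x + y) = dot w x + dot w y.
Proof. by rewrite dotC dotDl !(dotC w). Qed.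

Lemma dotZr a x w : dot w (a *: x) = a * dot w x.
Proof. by rewrite dotC dotZl dotC. Qed.

Lemma dot0r x : dot x 0 = 0.
Proof. by apply: big1 => i _; rewrite mxE mulr0. Qed.

Lemma dot_delta i x : dot (delta_mx 0 i) x = x 0 i.
Proof.
rewrite /dot (bigD1 i)//= big1 ?addr0; first by rewrite mxE !eqxx mul1r.
by move=> j /negPf ji; rewrite mxE eqxx ji mul0r.
Qed.

Lemma dotxx_ge0 x : 0 <= dot x x.
Proof. by apply: sumr_ge0 => i _; rewrite -expr2 sqr_ge0. Qed.

Lemma dotxx_eq0 x : (dot x x == 0) = (x == 0).
Proof.
apply/idP/idP => [|/eqP->]; last by rewrite dot0r.
rewrite psumr_eq0; last by move=> i _; rewrite -expr2 sqr_ge0.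
move=> /allP x0; apply/eqP/rowP => i; rewrite mxE.
by have := x0 i (mem_index_enum _); rewrite /= -expr2 sqrf_eq0 => /eqP.
Qed.

Lemma enorm_ge0 x : 0 <= enorm x.
Proof. exact: sqrtr_ge0. Qed.

Lemma sqr_enorm x : enorm x ^+ 2 = dot x x.
Proof. by rewrite sqr_sqrtr// dotxx_ge0. Qed.

Lemma enorm_eq0 x : (enorm x == 0) = (x == 0).
Proof. by rewrite -sqrf_eq0 sqr_enorm dotxx_eq0. Qed.

Lemma enorm_gt0 x : x != 0 -> 0 < enorm x.
Proof. by move=> x0; rewrite lt_neqAle eq_sym enorm_eq0 x0 enorm_ge0. Qed.

Lemma enorm0 : enorm (0 : 'rV[R]_n) = 0.
Proof. by apply/eqP; rewrite enorm_eq0. Qed.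

Lemma enormZ a x : enorm (a *: x) = `|a| * enorm x.
Proof.
by rewrite /enorm dotZl dotZr mulrA -expr2 sqrtrM ?sqr_ge0// sqrtr_sqr.
Qed.

Lemma direction_sphere x : x != 0 -> sphere (direction x).
Proof.
move=> x0; rewrite /sphere /direction /= enormZ ger0_norm ?invr_ge0 ?enorm_ge0//.
by rewrite mulVf// enorm_eq0.
Qed.

Lemma sphere_neq0 w : sphere w -> w != 0.
Proof. by move=> w1; rewrite -enorm_eq0 w1 oner_eq0. Qed.

Lemma direction_id w : sphere w -> direction w = w.
Proof. by rewrite /direction => ->; rewrite invr1 scale1r. Qed.

Lemma directionZ a x : 0 < a -> direction (a *: x) = direction x.
Proof.
move=> a0; rewrite /direction enormZ gtr0_norm// scalerA invfM mulrAC mulVf ?mul1r//.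
exact: lt0r_neq0.
Qed.

Lemma enorm_direction x : enorm x *: direction x = x.
Proof.
have [->|x0] := eqVneq x 0; first by rewrite /direction !scaler0.
by rewrite scalerA mulfV ?scale1r// enorm_eq0.
Qed.

Lemma dot_sphere w : sphere w -> dot w w = 1.
Proof. by move=> w1; rewrite -sqr_enorm w1 expr1n. Qed.

Lemma dot_sphere_le1 w x : sphere w -> sphere x -> `|dot w x| <= 1.
Proof.
move=> /dot_sphere w1 /dot_sphere x1.
(* For unit vectors |w + x|^2 and |w - x|^2 are 2 + 2 w . x and 2 - 2 w . x. *)
have := dotxx_ge0 (w + x); have := dotxx_ge0 (w + (-1) *: x).
rewrite !dotDl !dotDr !dotZl !dotZr w1 x1 (dotC x w) ler_norml; lra.
Qed.

Lemma coord_sphere_le1 w i : sphere w -> `|w 0 i| <= 1.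
Proof.
move=> ws; rewrite -dot_delta dotC; apply: dot_sphere_le1 => //.
by rewrite /sphere /= /enorm dot_delta mxE !eqxx sqrtr1.
Qed.

End dot_product.

Section derive_lambda.
Context (R : realType) (V : normedModType R).
Implicit Types (x v : V) (F G : V -> R).

Lemma is_derive_mul F G x v (df dg : R) :
  is_derive x v F df -> is_derive x v G dg ->
  is_derive x v (fun y => F y * G y) (df * G x + F x * dg).
Proof.
move=> dF dG; apply: (is_derive_eq (is_deriveM dF dG)).
by rewrite addrC [_ *: df]mulrC.
Qed.

Lemma is_derive_add F G x v (df dg : R) :
  is_derive x v F df -> is_derive x v G dg ->
  is_derive x v (fun y => F y + G y) (df + dg).
Proof. exact: is_deriveD. Qed.

Lemma is_derive_mulr F x v (c df : R) :
  is_derive x v F df -> is_derive x v (fun y => F y * c) (df * c).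
Proof.
move=> dF; apply: (is_derive_eq (is_derive_mul dF (is_derive_cst c x v))).
by rewrite mulr0 addr0.
Qed.

End derive_lambda.

(** * Directional derivatives as derivatives in one variable *)

Section derive_along_line.
Context (R : realType) (V : normedModType R).
Implicit Types (x v : V) (F : V -> R).

Lemma is_derive_line F x v (s df : R) : is_derive (s *: v + x) v F df ->
  is_derive s 1 (fun t : R => F (t *: v + x)) df.
Proof.
move=> [dF <-].
have E : (fun h : R => h^-1 *: (((fun t : R => F (t *: v + x)) \o shift s) (h *: 1) - F (s *: v + x)))
  = (fun h : R => h^-1 *: ((F \o shift (s *: v + x)) (h *: v) - F (s *: v + x))).
  by apply/funext => h /=; rewrite [_%:A]mulr1 scalerDl addrA.
by split; rewrite /derivable /derive E.
Qed.

Lemma line_is_derive F x v (df : R) :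
  is_derive (0 : R) 1 (fun t : R => F (t *: v + x)) df -> is_derive x v F df.
Proof.
move=> [dF <-].
have E : (fun h : R => h^-1 *: (((fun t : R => F (t *: v + x)) \o shift 0) (h *: 1) - F (0 *: v + x)))
  = (fun h : R => h^-1 *: ((F \o shift x) (h *: v) - F x)).
  by apply/funext => h /=; rewrite [_%:A]mulr1 addr0 scale0r add0r.
by split; [move: dF|]; rewrite /derivable /derive E.
Qed.

(** A directional derivative sees [F] only on the line through x, so the chain rule of one variable
    is enough. *)
Lemma is_derive_comp F x v (g : R -> R) (df dg : R) : is_derive x v F df ->
  is_derive (F x) 1 g dg -> is_derive x v (fun y => g (F y)) (dg * df).
Proof.
move=> dF dG; apply: line_is_derive.
apply: (@is_derive1_comp _ g (fun t : R => F (t *: v + x))).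
  by rewrite scale0r add0r.
by apply: is_derive_line; rewrite scale0r add0r.
Qed.

Lemma is_derive_scale F x v (c df : R) :
  is_derive x v F df -> is_derive x (c *: v) F (c * df).
Proof.
move=> dF; apply: line_is_derive.
under eq_fun do rewrite scalerA.
rewrite mulrC; apply: (@is_derive1_comp _ (fun t : R => F (t *: v + x)) (fun t => t * c)).
  by apply: is_derive_line; rewrite mul0r scale0r add0r.
apply: (is_derive_eq (is_derive_mulr c (is_derive_id (0 : R) 1))).
by rewrite mul1r.
Qed.

Lemma MVT_line F x v (df : R -> R) :
  (forall t : R, 0 <= t <= 1 -> is_derive (t *: v + x) v F (df t)) ->
  exists2 t : R, 0 <= t <= 1 & F (v + x) - F x = df t.
Proof.
move=> dF.
have dL (t : R) : 0 <= t <= 1 -> is_derive t 1 (fun t : R => F (t *: v + x)) (df t).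
  by move=> t01; exact/is_derive_line/dF.
have [||t] := @MVT_segment R (fun t : R => F (t *: v + x)) df 0 1 ler01.
- by move=> t; rewrite in_itv/= => /andP[/ltW t0 /ltW t1]; apply: dL; rewrite t0.
- apply: derivable_within_continuous => t; rewrite in_itv/= => t01.
  exact: (ex_derive (is_derive := dL _ t01)).
- rewrite in_itv/= => t01; rewrite scale1r scale0r add0r subr0 mulr1 => E.
  by exists t.
Qed.

End derive_along_line.

Section directional_derivatives.
Context (R : realType) (n : nat).
Implicit Types (x v : 'rV[R]_n) (F G : 'rV[R]_n -> R).

Lemma is_derive_coord x v i : is_derive x v (fun y => y 0 i) (v 0 i).
Proof.
apply: line_is_derive.
under eq_fun do rewrite !mxE.
have d1 := is_derive_mulr (v 0 i) (is_derive_id (0 : R) 1).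
apply: (is_derive_eq (is_derive_add d1 (is_derive_cst (x 0 i) (0 : R) 1))).
by rewrite mul1r addr0.
Qed.

Lemma is_derive_sqnorm x v : is_derive x v (fun y => dot y y) (2 * dot x v).
Proof.
rewrite (_ : (fun _ => _) = \sum_i (fun y : 'rV[R]_n => y 0 i * y 0 i)).
  rewrite mulr_sumr; apply: is_derive_sum => i.
  have d1 := is_derive_coord x v i.
  by apply: (is_derive_eq (is_derive_mul d1 d1)); ring.
by apply/funext => y; rewrite /dot fct_sumE.
Qed.

Lemma is_derive_inv_enorm x v : x != 0 ->
  is_derive x v (fun y => (enorm y)^-1) (- dot x v * (enorm x)^-1 ^+ 3).
Proof.
move=> x0; have e0 := enorm_gt0 x0.
have d1 : is_derive x v (fun y => enorm y) ((enorm x)^-1 * dot x v).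
  have dx : 0 < dot x x by rewrite -sqr_enorm exprn_gt0.
  apply: (is_derive_eq (is_derive_comp (is_derive_sqnorm x v) (is_derive1_sqrt dx))).
  change (Num.sqrt (dot x x)) with (enorm x); field; exact: lt0r_neq0.
have [d2 d3] := d1; split; first by apply: derivableV => //; exact: lt0r_neq0.
rewrite deriveV ?lt0r_neq0// d3 /GRing.scale /= exprVn -!exprVn; ring.
Qed.

End directional_derivatives.

Lemma cvg_sum_seq (R : realType) (T : Type) (F : set_system T) {FF : Filter F}
    (I : Type) (r : seq I) (f : I -> T -> R) (l : I -> R) :
  (forall i, f i x @[x --> F] --> l i) ->
  (\sum_(i <- r) f i x) @[x --> F] --> \sum_(i <- r) l i.
Proof.
move=> fl; elim: r => [|i r IH].
  by under eq_fun do rewrite big_nil; rewrite big_nil; exact: cvg_cst.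
by under eq_fun do rewrite big_cons; rewrite big_cons; exact: cvgD.
Qed.

(** * Functions with continuous partial derivatives *)

Section Ck.
Context (R : realType) (n : nat) (U : set 'rV[R]_n).
Hypothesis oU : open U.
Implicit Types (x v : 'rV[R]_n) (F G : 'rV[R]_n -> R) (k : nat).
Local Notation e_ i := (delta_mx 0 i : 'rV[R]_n).

Let nearU x : U x -> \near x, U x.
Proof. by move=> Ux; exact: open_nbhs_nbhs. Qed.

Lemma continuous_congr F G x : (forall y, U y -> F y = G y) -> U x ->
  {for x, continuous F} -> {for x, continuous G}.
Proof.
move=> FG Ux cF; rewrite /prop_for /continuous_at -FG//; apply: cvg_trans cF.
suff /near_eq_cvg : {near x, F =1 G} by [].
by near=> y; apply: FG; near: y; exact: nearU.
Unshelve. all: by end_near. Qed.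

Lemma partials_Ck_congr k F G : (forall y, U y -> F y = G y) ->
  partials_Ck k U F -> partials_Ck k U G.
Proof.
elim: k F G => [|k IH] F G FG /=; first by move=> cF x Ux; exact: continuous_congr (cF x Ux).
have nFG x : U x -> \near x, F x = G x.
  by move=> Ux; near=> y; apply: FG; near: y; exact: nearU.
move=> CF i; have [dF CdF] := CF i; split.
  by move=> x Ux; apply: near_eq_derivable (dF x Ux); exact: nFG.
by apply: IH CdF => y Uy; apply: near_eq_derive; exact: nFG.
Unshelve. all: by end_near. Qed.

(** Moving from x to y one coordinate at a time, each move is parallel to an axis and the mean value
    theorem turns it into a single partial derivative, which differs from its value at x by at most
    eps. *)
Lemma partials_C1_taylor F x (eps : R) : partials_Ck 1 U F -> U x -> 0 < eps ->
  \forall y \near x, `|F y - F x - \sum_i (y 0 i - x 0 i) * 'D_(e_ i) F x|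
    <= eps * \sum_i `|y 0 i - x 0 i|.
Proof.
move=> CF Ux eps0.
have bnd i : \forall y \near x, `|'D_(e_ i) F y - 'D_(e_ i) F x| <= eps.
  have cD := (CF i).2 x Ux.
  by have /cvgrPdist_le/(_ _ eps0) := cD; apply: filterS => y; rewrite distrC.
have /nbhs_ballP[r /= r0 rU] : \forall y \near x,
    U y /\ forall i, `|'D_(e_ i) F y - 'D_(e_ i) F x| <= eps.
  near=> y; split; first by near: y; exact: nearU.
  by near: y; apply: filter_forall => i; exact: bnd.
apply/nbhs_ballP; exists r => //= y [_ xy].
(* The corners of the path: the first k coordinates are already those of y. The segments between
   them stay in the ball because the norm is the max norm. *)
pose z k : 'rV[R]_n := \row_j (if (j < k)%N then y 0 j else x 0 j).
pose d i := (y 0 i - x 0 i) * 'D_(e_ i) F x.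
have step (k : nat) (kn : (k < n)%N) (i := Ordinal kn) :
    `|F (z k.+1) - F (z k) - d i| <= eps * `|y 0 i - x 0 i|.
  pose v := (y 0 i - x 0 i) *: e_ i.
  have zE : z k.+1 = v + z k.
    apply/rowP => j; rewrite !mxE eqxx/= ltnS leq_eqVlt -val_eqE /=.
    case: eqVneq => [jk|_]/=; last by rewrite mulr0 add0r.
    by rewrite (_ : i = j) ?jk ?ltnn ?mulr1 ?subrK//; exact/val_inj.
  have inb (t : R) : 0 <= t <= 1 -> ball x r (t *: v + z k).
    move=> /andP[t0 t1]; split=> // a j; rewrite (ord1 a) !mxE eqxx/= -val_eqE /=.
    have xyj := xy 0 j; have [jk|/= jk] := eqVneq (j : nat) k.
      have -> : i = j by exact/val_inj.
      rewrite jk ltnn mulr1 /ball/= opprD addrCA subrr addr0 normrN normrM ger0_norm//.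
      by apply: le_lt_trans xyj; rewrite distrC ler_piMl.
    rewrite !mulr0 add0r; case: ifP => _ //; exact: ballxx.
  have [|t t01] := @MVT_line R _ F (z k) v (fun t => (y 0 i - x 0 i) * 'D_(e_ i) F (t *: v + z k)).
    move=> t /inb/rU[Uz _]; apply: is_derive_scale; apply: derivableP; exact: (CF i).1.
  rewrite zE => ->; rewrite -mulrBr normrM mulrC ler_wpM2r//.
  by case: (rU _ (inb _ t01)).
have tel k : (k <= n)%N -> `|F (z k) - F x - \sum_(i < n | (i < k)%N) d i|
    <= eps * \sum_(i < n | (i < k)%N) `|y 0 i - x 0 i|.
  elim: k => [_|k IH kn].
    rewrite !big_pred0_eq mulr0 (_ : z 0%N = x) ?subrr ?subr0 ?normr0//.
    by apply/rowP => j; rewrite mxE.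
  have sE (g : 'I_n -> R) : \sum_(i < n | (i < k.+1)%N) g i =
      g (Ordinal kn) + \sum_(i < n | (i < k)%N) g i.
    rewrite (bigD1 (Ordinal kn))//=; congr (_ + _); apply: eq_bigl => i.
    by rewrite ltnS leq_eqVlt -val_eqE/=; case: ltngtP.
  rewrite !sE mulrDr (le_trans _ (lerD (step _ kn) (IH (ltnW kn))))//.
  by rewrite (le_trans _ (ler_normD _ _))// le_eqVlt; apply/orP; left; apply/eqP; congr `|_|; ring.
have := tel n (leqnn n); rewrite (_ : z n = y); last by apply/rowP => j; rewrite mxE ltn_ord.
have sE (g : 'I_n -> R) : \sum_(i < n | (i < n)%N) g i = \sum_i g i.
  by apply: eq_bigl => i; rewrite ltn_ord.
by rewrite !sE.
Unshelve. all: by end_near. Qed.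

Let C1_lipschitz F x : partials_Ck 1 U F -> U x -> exists2 C, 0 <= C &
  \forall y \near x, `|F y - F x| <= C * \sum_i `|y 0 i - x 0 i|.
Proof.
move=> CF Ux; exists (1 + \sum_i `|'D_(e_ i) F x|).
  by rewrite addr_ge0// sumr_ge0.
apply: filterS (partials_C1_taylor CF Ux ltr01) => y /= T.
rewrite -[X in `|X|](subrK (\sum_i (y 0 i - x 0 i) * 'D_(e_ i) F x)).
rewrite (le_trans (ler_normD _ _))// mulrDl lerD//.
rewrite (le_trans (ler_norm_sum _ _ _))// mulr_sumr ler_sum// => i _.
by rewrite normrM mulrC ler_wpM2r// (bigD1 i)//= lerDl sumr_ge0.
Qed.

Lemma partials_C1_continuous F x : partials_Ck 1 U F -> U x ->
  {for x, continuous F}.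
Proof.
move=> CF Ux; have [C C0 FC] := C1_lipschitz CF Ux.
apply/(@cvgrPdist_le _ _ _ (nbhs x)) => e e0.
have C1 : 0 < C + 1 by rewrite ltr_wpDl.
have cS : (\sum_i `|y 0 i - x 0 i|) @[y --> x] --> \sum_(i < n) `|x 0 i - x 0 i|.
  apply: (@cvg_sum_seq R _ (nbhs x) (nbhs_filter x)) => i.
  apply: cvg_norm; apply: cvgB; last exact: cvg_cst.
  exact: coord_continuous.
move: cS; rewrite big1; last by move=> i _; rewrite subrr normr0.
have eC : 0 < e / (C + 1) by rewrite divr_gt0.
move=> /cvgrPdist_le/(_ _ eC) S.
near=> y; rewrite distrC (@le_trans _ _ (C * \sum_i `|y 0 i - x 0 i|))//.
  by near: y; exact: FC.
have : `|0 - \sum_i `|y 0 i - x 0 i| | <= e / (C + 1) by near: y; exact: S.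
rewrite sub0r normrN ger0_norm; last by apply: sumr_ge0.
rewrite ler_pdivlMr// => /(le_trans _); apply; rewrite mulrDr mulr1 mulrC lerDl.
exact: sumr_ge0.
Unshelve. all: by end_near. Qed.

(** [partials_Ck k.+1] constrains the derivatives and not the function itself, so even continuity
    has to be recovered; the expansion above does it at the bottom of the induction. *)
Lemma partials_CkW k F : partials_Ck k.+1 U F -> partials_Ck k U F.
Proof.
elim: k F => [|k IH] F CF; first by move=> x Ux; exact: partials_C1_continuous.
by move=> i; have [dF CdF] := CF i; split=> //; exact: IH.
Qed.

Lemma partials_Ck_cst k c : partials_Ck k U (cst c).
Proof.
elim: k c => [|k IH] c /=; first by move=> x _; exact: cst_continuous.
move=> i; split=> [x _|]; first exact: derivable_cst.
by apply: partials_Ck_congr (IH 0) => y _; rewrite derive_cst.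
Qed.

Lemma partials_CkD k F G : partials_Ck k U F -> partials_Ck k U G ->
  partials_Ck k U (fun x => F x + G x).
Proof.
elim: k F G => [|k IH] F G CF CG /=.
  by move=> x Ux; apply: continuousD; [exact: CF|exact: CG].
move=> i; have [dF CdF] := CF i; have [dG CdG] := CG i; split=> [x Ux|].
  by apply: derivableD; [exact: dF|exact: dG].
apply: partials_Ck_congr (IH _ _ CdF CdG) => y Uy.
by rewrite deriveD//; [exact: dF|exact: dG].
Qed.

Lemma partials_CkM k F G : partials_Ck k U F -> partials_Ck k U G ->
  partials_Ck k U (fun x => F x * G x).
Proof.
elim: k F G => [|k IH] F G CF CG /=.
  by move=> x Ux; apply: continuousM; [exact: CF|exact: CG].
move=> i; have [dF CdF] := CF i; have [dG CdG] := CG i.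
have dE x : U x -> is_derive x (e_ i) (fun x => F x * G x)
    ('D_(e_ i) F x * G x + F x * 'D_(e_ i) G x).
  by move=> Ux; apply: is_derive_mul; apply: derivableP; [exact: dF|exact: dG].
split=> [x Ux|]; first exact: (ex_derive (is_derive := dE x Ux)).
apply: partials_Ck_congr (partials_CkD (IH _ _ CdF (partials_CkW CG))
  (IH _ _ (partials_CkW CF) CdG)) => y Uy.
by rewrite (derive_val (is_derive := dE y Uy)).
Qed.

Lemma partials_Ck_sum k (I : Type) (r : seq I) (H : I -> 'rV[R]_n -> R) :
  (forall i, partials_Ck k U (H i)) ->
  partials_Ck k U (fun x => \sum_(i <- r) H i x).
Proof.
move=> CH; elim: r => [|i r IH].
  by apply: partials_Ck_congr (partials_Ck_cst k 0) => y _; rewrite big_nil.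
by apply: partials_Ck_congr (partials_CkD (CH i) IH) => y _; rewrite big_cons.
Qed.

Lemma partials_CkX k F m : partials_Ck k U F -> partials_Ck k U (fun x => F x ^+ m).
Proof.
move=> CF; elim: m => [|m IH].
  by apply: partials_Ck_congr (partials_Ck_cst k 1) => y _; rewrite expr0.
by apply: partials_Ck_congr (partials_CkM CF IH) => y _; rewrite exprS.
Qed.

Lemma partials_Ck_coord k i : partials_Ck k U (fun x => x 0 i).
Proof.
case: k => [|k] /=; first by move=> x _; exact: coord_continuous.
move=> j; split=> [x _|].
  exact: (ex_derive (is_derive := is_derive_coord x (e_ j) i)).
apply: partials_Ck_congr (partials_Ck_cst k (e_ j 0 i)) => y _.
by rewrite (derive_val (is_derive := is_derive_coord y (e_ j) i)).
Qed.

Lemma partials_Ck_expR k F : partials_Ck k U F ->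
  partials_Ck k U (fun x => expR (F x)).
Proof.
elim: k F => [|k IH] F CF /=.
  by move=> x Ux; apply: continuous_comp; [exact: CF|exact: continuous_expR].
move=> i; have [dF CdF] := CF i.
have dE x : U x -> is_derive x (e_ i) (fun x => expR (F x))
    (expR (F x) * 'D_(e_ i) F x).
  by move=> Ux; apply: is_derive_comp; apply: derivableP; exact: dF.
split=> [x Ux|]; first exact: (ex_derive (is_derive := dE x Ux)).
apply: partials_Ck_congr (partials_CkM (IH _ (partials_CkW CF)) CdF) => y Uy.
by rewrite (derive_val (is_derive := dE y Uy)).
Qed.

End Ck.

(** * Functions homogeneous of degree 0 *)

Section punctured_space.
Context (R : realType) (n : nat).
Implicit Types (x v w : 'rV[R]_n) (f : 'rV[R]_n -> R).
Local Notation e_ i := (delta_mx 0 i : 'rV[R]_n).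

Definition punctured : set 'rV[R]_n := [set x | x != 0].

Lemma open_punctured : open punctured.
Proof.
rewrite (_ : punctured = ~` [set 0]); last first.
  by apply/seteqP; split=> x /=; move/eqP.
by rewrite openC; exact/accessible_closed_set1/hausdorff_accessible/norm_hausdorff.
Qed.

Lemma near_punctured x : x != 0 -> \near x, x != 0.
Proof. by move=> x0; exact: (open_nbhs_nbhs (conj open_punctured x0)). Qed.

(** The derivative - x_i |x|^-3 is a polynomial in the coordinates and |x|^-1, so the induction
    closes on |x|^-1 itself. The norm is recovered from it as |x|^2 |x|^-1. *)
Lemma partials_Ck_inv_enorm k : partials_Ck k punctured (fun x => (enorm x)^-1).
Proof.
have oP := open_punctured.
elim: k => [|k IH] /=.
  move=> x x0; have e0 := enorm_gt0 x0.
  apply: (@continuous_comp _ _ _ (fun x : 'rV[R]_n => enorm x) (fun r : R => r^-1)).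
    apply: (@continuous_comp _ _ _ (fun x : 'rV[R]_n => dot x x) Num.sqrt).
      apply: (partials_Ck_sum (k := 0) oP) => // i.
      by apply: (partials_CkM (k := 0) oP); exact: (partials_Ck_coord oP 0).
    exact: sqrt_continuous.
  exact/inv_continuous/lt0r_neq0.
move=> i; split=> [x x0|].
  exact: (ex_derive (is_derive := is_derive_inv_enorm (e_ i) x0)).
have C3 := partials_CkM oP (partials_CkM oP (partials_Ck_cst oP k (-1)) (partials_Ck_coord oP k i))
  (partials_CkX oP 3 IH).
apply: partials_Ck_congr C3 => // x x0.
rewrite (derive_val (is_derive := is_derive_inv_enorm (e_ i) x0)).
by rewrite dotC dot_delta mulN1r.
Qed.

Lemma partials_Ck_direction k i : partials_Ck k punctured (fun x => direction x 0 i).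
Proof.
have oP := open_punctured.
apply: partials_Ck_congr (partials_CkM oP (partials_Ck_inv_enorm k) (partials_Ck_coord oP k i)) => //.
by move=> x _; rewrite mxE.
Qed.

Lemma partials_Ck_dot_direction k w : partials_Ck k punctured (fun x => dot (direction x) w).
Proof.
have oP := open_punctured.
apply: partials_Ck_sum => // i; apply: partials_CkM => //.
  exact: partials_Ck_direction.
exact: partials_Ck_cst.
Qed.

Lemma tangent_projE w v i : tangent_proj w v 0 i = v 0 i - dot w v * w 0 i.
Proof. by rewrite !mxE. Qed.

Lemma dot_tangent_proj w v : sphere w -> dot w (tangent_proj w v) = 0.
Proof.
by move=> /dot_sphere w1; rewrite /tangent_proj -scaleNr dotDr dotZr w1 mulr1 subrr.
Qed.

Lemma is_derive_direction x v i : x != 0 ->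
  is_derive x v (fun y => direction y 0 i)
    ((enorm x)^-1 * tangent_proj (direction x) v 0 i).
Proof.
move=> x0; rewrite (_ : (fun _ => _) = fun y => (enorm y)^-1 * y 0 i); last first.
  by apply/funext => y; rewrite mxE.
apply: (is_derive_eq (is_derive_mul (is_derive_inv_enorm v x0) (is_derive_coord x v i))).
by rewrite tangent_projE /direction dotZl mxE; ring.
Qed.

Lemma is_derive_dot_direction x v w : x != 0 ->
  is_derive x v (fun y => dot (direction y) w)
    ((enorm x)^-1 * dot v (tangent_proj (direction x) w)).
Proof.
move=> x0; rewrite (_ : (fun _ => _) = \sum_i (fun y : 'rV[R]_n => direction y 0 i * w 0 i)).
  rewrite (_ : _ * _ = \sum_i (enorm x)^-1 * tangent_proj (direction x) v 0 i * w 0 i).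
    by apply: is_derive_sum => i; exact/is_derive_mulr/is_derive_direction.
  under eq_bigr do rewrite -mulrA; rewrite -mulr_sumr; congr (_ * _).
  rewrite -/(dot _ _) /tangent_proj -!scaleNr dotDr dotDl !dotZl dotZr (dotC v (direction x)) dotZl.
  by ring.
by apply/funext => y; rewrite /dot fct_sumE.
Qed.

(** A function that is constant on rays has derivatives of degree -1, since dilating the point by c
    dilates the line by c. *)
Lemma is_derive_homogeneous f w v (c df : R) : 0 < c ->
  is_derive w v (f \o @direction R n) df ->
  is_derive (c *: w) v (f \o @direction R n) (c^-1 * df).
Proof.
move=> c0 dF; apply: line_is_derive.
rewrite (_ : (fun _ => _) = (fun t : R => (f \o @direction R n) (t *: v + w)) \o (fun t : R => t * c^-1)).
  rewrite mulrC; apply: is_derive1_comp.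
    by apply: is_derive_line; rewrite mul0r scale0r add0r.
  by apply: (is_derive_eq (is_derive_mulr c^-1 (is_derive_id (0 : R) 1))); rewrite mul1r.
apply/funext => t /=; rewrite -[in RHS](@directionZ _ _ c)// scalerDr scalerA mulrCA mulfV ?mulr1//.
exact: lt0r_neq0.
Qed.

Lemma derive_homogeneous f x v : x != 0 ->
  derivable (f \o @direction R n) (direction x) v ->
  'D_v (f \o @direction R n) x = (enorm x)^-1 * 'D_v (f \o @direction R n) (direction x).
Proof.
move=> x0 /derivableP/(is_derive_homogeneous (enorm_gt0 x0)).
by rewrite enorm_direction => dF; rewrite (derive_val (is_derive := dF)).
Qed.

(** The extension is constant on the ray through x, but the direction x is not a coordinate axis:
    the link between the ray and the partial derivatives is the first-order expansion at (1 + t)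
    x. *)
Lemma radial_derivative f x : sphere_Ck 1 f -> x != 0 ->
  \sum_i x 0 i * 'D_(e_ i) (f \o @direction R n) x = 0.
Proof.
move=> Cf x0; set S := \sum_i _; apply/eqP; rewrite -normr_le0; apply/ler_addgt0Pr => e e0.
(* With tolerance e / M the expansion yields t |S| <= t e; the summand 1 makes M positive. *)
pose M := 1 + \sum_i `|x 0 i|.
have M0 : 0 < M by rewrite ltr_pwDl// sumr_ge0.
have T := partials_C1_taylor open_punctured Cf x0 (divr_gt0 e0 M0).
have L : (t *: x + x) @[t --> (0 : R)^'+] --> 0 *: x + x.
  apply: cvgD; last exact: cvg_cst.
  by apply: cvgZr_tmp; apply: cvg_at_right_filter; exact: cvg_id.
rewrite scale0r add0r in L.
have {L T} := L _ T; rewrite -/(nbhs _ _) => T.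
have [t [/= t0 {T}]] : exists t : R, 0 < t /\ `|(f \o @direction R n) (t *: x + x) - (f \o @direction R n) x
   - \sum_i ((t *: x + x) 0 i - x 0 i) * 'D_(e_ i) (f \o @direction R n) x|
     <= e / M * \sum_i `|(t *: x + x) 0 i - x 0 i|.
  near (0 : R)^'+ => t; exists t; split=> //.
  by near: t; exact: T.
have -> : direction (t *: x + x) = direction x.
  by rewrite -[X in _ + X]scale1r -scalerDl directionZ ?addr_gt0.
rewrite subrr sub0r normrN.
under eq_bigr do rewrite !mxE addrK -mulrA.
under [in leRHS]eq_bigr do rewrite !mxE addrK normrM.
rewrite -!mulr_sumr normrM mulrCA gtr0_norm// ler_pM2l// => /le_trans; apply.
rewrite add0r mulrAC ler_pdivrMr// ler_pM2l// /M lerDr.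
Unshelve. all: by end_near. Qed.

End punctured_space.

Lemma exists_other_index n (i : 'I_n) : (2 <= n)%N -> exists j : 'I_n, j != i.
Proof.
case: n i => [|[|n]] // i _.
have [->|i0] := eqVneq i ord0; first by exists ord_max.
by exists ord0; rewrite eq_sym.
Qed.

(* Any two points are joined by a path of segments parallel to the axes that
   avoids the origin, through the vector with all coordinates 1. *)
Lemma zero_partials_constant (R : realType) n (H : 'rV[R]_n -> R) : (2 <= n)%N ->
  (forall (x : 'rV[R]_n) i, x != 0 -> is_derive x (delta_mx 0 i) H 0) ->
  forall x y : 'rV[R]_n, x != 0 -> y != 0 -> H x = H y.
Proof.
move=> n2 dH.
have step (x : 'rV[R]_n) i j (c : R) : j != i -> x 0 j != 0 -> H (c *: delta_mx 0 i + x) = H x.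
  move=> ji xj; apply/eqP; rewrite -subr_eq0.
  have [|t _ ->//] := @MVT_line R _ H x (c *: delta_mx 0 i) (fun=> 0).
  move=> t _; rewrite -[X in is_derive _ _ _ X](mulr0 c).
  apply/is_derive_scale/dH/eqP => /rowP/(_ j)/eqP.
  by rewrite !mxE (negPf ji) !mulr0 add0r (negPf xj).
pose ones (s : seq 'I_n) (x : 'rV[R]_n) : 'rV[R]_n := \row_k (if k \in s then 1 else x 0 k).
have upd x i s j : j != i -> ones s x 0 j != 0 -> H (ones (i :: s) x) = H (ones s x).
  move=> ji /(step _ i _ (1 - ones s x 0 i) ji) <-; congr (H _).
  apply/rowP => k; rewrite !mxE eqxx in_cons; case: eqVneq => [->|_]/=.
    by rewrite mulr1 subrK.
  by rewrite mulr0 add0r.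
suff to1 (x : 'rV[R]_n) : x != 0 -> H x = H (const_mx 1) by move=> x y x0 y0; rewrite !to1.
move=> x0; have [i xi] : exists i, x 0 i != 0.
  apply/existsP; rewrite -negb_forall; apply: contra x0 => /forallP x0.
  by apply/eqP/rowP => i; rewrite mxE; apply/eqP.
have Hs s : i \notin s -> H (ones s x) = H x.
  elim: s => [_|k s IH]; first by congr (H _); apply/rowP => k; rewrite mxE.
  rewrite in_cons negb_or => /andP[ik si].
  by rewrite (upd _ _ _ i) ?IH// mxE (negPf si).
(* While all other coordinates are set to 1, the nonzero coordinate i keeps the path off the origin.
   Then i itself is reset, and some j != i, now equal to 1, takes over this role; here n >= 2 is
   used. *)
rewrite -(Hs [seq k <- enum 'I_n | k != i]); last by rewrite mem_filter eqxx.
have [j ji] := exists_other_index i n2.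
rewrite -(upd _ i _ j ji); last by rewrite mxE mem_filter ji mem_enum oner_eq0.
congr (H _).
apply/rowP => k; rewrite !mxE in_cons mem_filter mem_enum andbT.
by case: eqVneq.
Qed.

(** * Lebesgue measure on tuples *)

Section borel_row.
Context (R : realType) (n : nat).
Local Notation T := (measurableTypeR R).

Lemma open_measurable_rV (U : set 'rV[R]_n) : open U -> measurable (U : set (borel_rV R n)).
Proof. by move=> oU; exact: sub_gen_smallest. Qed.

Lemma closed_measurable_rV (A : set 'rV[R]_n) : closed A -> measurable (A : set (borel_rV R n)).
Proof.
by move=> cA; rewrite -[A]setCK; apply: measurableC; apply: open_measurable_rV; rewrite openC.
Qed.

Lemma continuous_measurable_rV (U : set 'rV[R]_n) (F : 'rV[R]_n -> R) : open U ->
  (forall x, U x -> {for x, continuous F}) ->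
  measurable_fun (U : set (borel_rV R n)) (F : borel_rV R n -> T).
Proof.
move=> oU cF; apply: (measurability _ (RGenOpens.measurableE R)) => _ [_ [a [b ->]] <-].
apply: open_measurable_rV; rewrite openE => x [Ux Fx].
have oab : open `]a, b[%classic by exact: interval_open.
have N1 : nbhs x U by exact: open_nbhs_nbhs.
have N2 : nbhs x (F @^-1` `]a, b[%classic) by apply: cF => //; exact: open_nbhs_nbhs.
exact: filterI N1 N2.
Qed.

(** Tuples carry the product sigma-algebra and rows the Borel one. An open set is the union of the
    countably many cubes with rational centre and radius 1 / (k + 1) that it contains, and cubes are
    measurable coordinatewise. *)
Lemma measurable_row_of_tuple : measurable_fun setT (@row_of_tuple R n).
Proof.
apply: (@measurability _ _ _ _ setT (@row_of_tuple R n) (@open 'rV[R]_n)) => //.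
move=> _ [U oU <-]; rewrite setTI.
pose rv (q : {ffun 'I_n -> rat}) : 'rV[R]_n := \row_i ratr (q i).
pose box (p : {ffun 'I_n -> rat} * nat) := ball (rv p.1) p.2.+1%:R^-1.
have mbox p : measurable (@row_of_tuple R n @^-1` box p).
  rewrite (_ : _ @^-1` _ = \bigcap_(i in [set: 'I_n])
      ((fun t : n.-tuple T => tnth t i) @^-1` ball (ratr (p.1 i) : R) p.2.+1%:R^-1)).
    apply: fin_bigcap_measurable => [|i _]; first exact: finite_finset.
    by rewrite -[X in measurable X]setTI; apply: measurable_tnth => //; exact: measurable_ball.
  apply/seteqP; split => [t [_ bt] i _|t bt]; first by have := bt 0 i; rewrite !mxE.
  by split=> // i j; rewrite !mxE; exact: bt.
rewrite (_ : _ @^-1` _ = \bigcup_(p in [set p | box p `<=` U]) (@row_of_tuple R n @^-1` box p)).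
  by rewrite bigcup_mkcond; apply: countable_bigcupT_measurable => // p; case: ifP.
apply/seteqP; split => [t Ut|t [p pU] /pU//].
have /nbhs_ballP[e /= e0 eU] : nbhs (row_of_tuple t : 'rV[R]_n) U by exact: open_nbhs_nbhs.
have [k _ /(_ k (leqnn k)) /= ke] := near_infty_natSinv_lt (PosNum (divr_gt0 e0 (ltr0Sn R 1))).
have k0 : 0 < k.+1%:R^-1 :> R by rewrite invr_gt0.
have /choice[q qP] i : exists q : rat, ball (ratr q : R) k.+1%:R^-1 (tnth t i : R).
  have [|q] := @rat_in_itvoo R (tnth t i - k.+1%:R^-1) (tnth t i + k.+1%:R^-1).
    by rewrite ltrD2l gtrN.
  by rewrite in_itv/= => ?; exists q; rewrite /ball/= ltr_distl.
pose p : {ffun 'I_n -> rat} * nat := ([ffun i => q i], k).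
have boxt : box p (row_of_tuple t).
  by split=> // i j; rewrite !mxE ffunE; exact: qP.
exists p => // x boxx; apply: eU; rewrite (splitr e).
apply: (@ball_triangle _ _ (rv p.1)); last by apply: le_ball (ltW ke) _ _.
by apply: ball_sym; apply: le_ball (ltW ke) _ _.
Qed.

End borel_row.

Section lebesgue_tuple.
Context (R : realType).
Local Notation T := (measurableTypeR R).
Local Notation mu := (@lebesgue_measure R).
Local Notation Leb n := (lebesgue_tuple R n).
Implicit Type n : nat.

(** The map along which [lebesgue_cons] pushes the product measure forward. *)
Definition tcons n (p : T * n.-tuple T) : n.+1.-tuple T := [tuple of p.1 :: p.2].

Lemma measurable_tcons n : measurable_fun setT (@tcons n).
Proof. exact: (measurable_cons measurable_fst measurable_snd). Qed.

Lemma tcons_ord0 n (p : T * n.-tuple T) : tnth (tcons p) ord0 = p.1.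
Proof. by rewrite (tnth_nth p.1). Qed.

Lemma tcons_lift n (p : T * n.-tuple T) i : tnth (tcons p) (lift ord0 i) = tnth p.2 i.
Proof. by rewrite !(tnth_nth p.1). Qed.

(** The centre is a sequence indexed by [nat], so that induction on the dimension only shifts it. *)
Definition cube n (c : nat -> R) (a : R) : set (n.-tuple T) :=
  [set t | forall i, `|tnth t i - c i| <= a].

Lemma measurable_cube n c a : measurable (@cube n c a).
Proof.
rewrite (_ : @cube n c a = \bigcap_(i in [set: 'I_n])
    ((fun t : n.-tuple T => tnth t i) @^-1` `[c i - a, c i + a]%classic)).
  apply: fin_bigcap_measurable => [|i _]; first exact: finite_finset.
  by rewrite -[X in measurable X]setTI; apply: measurable_tnth => //.
apply/seteqP; split=> [t ct i _|t ct i].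
  by rewrite /= in_itv/= -ler_distl; exact: ct.
by have := ct i Logic.I; rewrite /= in_itv/= -ler_distl.
Qed.

Lemma lebesgue_tuple_cube n (c : nat -> R) (a : R) : 0 <= a ->
  Leb n (@cube n c a) = ((2 * a) ^+ n)%:E.
Proof.
move=> a0; elim: n c => [|n IH] c.
  rewrite /= /dirac indicE mem_set//; by case.
have -> : Leb n.+1 (@cube n.+1 c a) = (mu \x Leb n)%E
    (`[c 0%N - a, c 0%N + a]%classic `*` @cube n (c \o S) a).
  rewrite [LHS]/= /lebesgue_cons /pushforward; congr (_ _).
  apply/seteqP; split=> [p cp|p [cp0 cp] i].
    split=> /=.
      by rewrite /= in_itv/= -ler_distl; have := cp ord0; rewrite tcons_ord0.
    by move=> i; have := cp (lift ord0 i); rewrite tcons_lift.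
  have [j ->|->] := unliftP ord0 i; first by rewrite tcons_lift; exact: cp.
  by rewrite tcons_ord0; move: cp0; rewrite /= in_itv/= -ler_distl.
have muI : mu `[c 0%N - a, c 0%N + a]%classic = (2 * a)%:E.
  rewrite lebesgue_measure_itv/= lte_fin; case: ltP => [_|H].
    by rewrite -EFinB; congr EFin; ring.
  by congr EFin; lra.
rewrite product_measure1E//; last exact: measurable_cube.
by rewrite exprS EFinM; congr (_ * _)%E; [exact: muI|exact: IH].
Qed.

Definition bounded_support n (g : n.-tuple T -> R) := exists C a : R,
  [/\ 0 <= C, 0 <= a, forall t, `|g t| <= C & forall t i, a < `|tnth t i| -> g t = 0].

Lemma bounded_support_integrable n (g : n.-tuple T -> R) :
  measurable_fun setT g -> bounded_support g -> (Leb n).-integrable setT (EFin \o g).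
Proof.
move=> mg [C [a [C0 a0 gC ga]]].
have mc : measurable (@cube n (fun=> 0) a) by exact: measurable_cube.
have gr : EFin \o g = (EFin \o g) \_ (@cube n (fun=> 0) a).
  apply/funext => t; rewrite patchE; case: ifPn => // /negP; rewrite inE => tc.
  have /existsNP[i] : ~ forall i, `|tnth t i - 0| <= a by [].
  by rewrite subr0 => /negP; rewrite -ltNge => /ga /= ->.
rewrite gr; apply/(integrable_mkcond _ mc).
apply: measurable_bounded_integrable => //.
- by apply: le_lt_trans (ltry ((2 * a) ^+ n)); rewrite -(@lebesgue_tuple_cube n (fun=> 0)).
- exact: measurable_funTS.
- by exists C; split=> [|x Cx t _]; [exact: num_real|exact: le_trans (gC t) (ltW Cx)].
Qed.

Lemma integral_lebesgue_tupleS n (g : n.+1.-tuple T -> R) :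
  measurable_fun setT g -> bounded_support g ->
  (mu \x Leb n)%E.-integrable setT (EFin \o (g \o @tcons n)) /\
  (\int[Leb n.+1]_t (g t)%:E = \int[mu \x Leb n]_p (g (tcons p))%:E)%E.
Proof.
move=> mg bg; have ig := bounded_support_integrable mg bg.
have mc := @measurable_tcons n.
have ip : (mu \x Leb n)%E.-integrable setT (EFin \o (g \o @tcons n)).
  apply/integrableP; split.
    by apply/measurable_EFinP; exact: measurableT_comp.
  move/integrableP : ig => [mg' ]; apply: le_lt_trans.
  have := @ge0_integral_pushforward _ _ _ _ R (@tcons n) mc (mu \x Leb n)%E setT
    (abse \o (EFin \o g)) measurableT.
  rewrite preimage_setT => <- //; first exact: measurableT_comp.
  by move=> x _; exact: abse_ge0.
split=> //; have := @integral_pushforward _ _ _ _ R (@tcons n) mc (mu \x Leb n)%E setT (EFin \o g).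
by rewrite preimage_setT => <- //; exact/measurable_EFinP.
Qed.

Definition tuple_upd n (i : 'I_n) (t : n.-tuple T) (s : R) : n.-tuple T :=
  [tuple if j == i then s : T else tnth t j | j < n].

(** Fubini in the order that suits i: the first coordinate is integrated innermost if it is
    coordinate i, and otherwise is frozen while the induction hypothesis handles the rest. *)
Lemma integral_lines0 n (i : 'I_n) (g : n.-tuple T -> R) :
  measurable_fun setT g -> bounded_support g ->
  (forall t, \int[mu]_s (g (tuple_upd i t s))%:E = 0)%E ->
  (\int[Leb n]_t (g t)%:E = 0)%E.
Proof.
elim: n i g => [[]//|n IH] i g mg bg g0.
have [ig ->] := integral_lebesgue_tupleS mg bg.
have [i' ii'|i0] := unliftP ord0 i; last first.
  rewrite -(integral21_prod_meas1 ig) /fubini_G integral0_eq// => t _.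
  rewrite -[RHS](g0 (tcons (0, t))); apply: eq_integral => s _ /=; congr (g _)%:E.
  apply: eq_from_tnth => j; rewrite tnth_mktuple i0.
  have [j' ->|->] := unliftP ord0 j; first by rewrite !tcons_lift.
  by rewrite tcons_ord0 eqxx.
rewrite -(integral12_prod_meas1 ig) /fubini_F integral0_eq// => s _ /=.
apply: (IH i' (fun t => g (tcons (s, t)))).
- apply: measurableT_comp => //.
  by apply: measurableT_comp; [exact: measurable_tcons|exact: measurable_fun_pair].
- move: bg => [C [a [C0 a0 gC ga]]]; exists C, a; split=> // t j tj.
  by apply: (ga _ (lift ord0 j)); rewrite tcons_lift.
- move=> t; rewrite -[RHS](g0 (tcons (s, t))); apply: eq_integral => r _; congr (g _)%:E.
  apply: eq_from_tnth => j; rewrite tnth_mktuple ii'.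
  have [j' ->|->] := unliftP ord0 j; last by rewrite !tcons_ord0.
  by rewrite !tcons_lift tnth_mktuple (inj_eq lift_inj).
Qed.

End lebesgue_tuple.

(** * Cutoff functions of class C^1 on the line *)

Section cutoff.
Context (R : realType).

(** Away from 0 this is the derivative of t^2 or - t^2; at 0 the difference quotient is |h|. *)
Let is_derive_mul_norm (t : R) : is_derive t 1 (fun t => t * `|t|) (2 * `|t|).
Proof.
have [t0|t0|->] := ltgtP t 0.
- have d1 : is_derive t 1 (fun t : R => t * t * -1) (2 * `|t|).
    apply: (is_derive_eq (is_derive_mulr (-1) (is_derive_mul (is_derive_id t 1) (is_derive_id t 1)))).
    by rewrite ltr0_norm//; ring.
  apply: near_eq_is_derive d1; near=> s.
  have s0 : s < 0 by near: s; exact: lt_nbhsl.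
  by rewrite ltr0_norm//; ring.
- have d1 : is_derive t 1 (fun t : R => t * t) (2 * `|t|).
    apply: (is_derive_eq (is_derive_mul (is_derive_id t 1) (is_derive_id t 1))).
    by rewrite gtr0_norm//; ring.
  apply: near_eq_is_derive d1; near=> s.
  have s0 : 0 < s by near: s; exact: lt_nbhsr.
  by rewrite gtr0_norm.
- rewrite normr0 mulr0.
  pose g (h : R) := h^-1 *: (((fun t : R => t * `|t|) \o shift 0) (h *: 1) - 0 * `|0 : R|) : R.
  have L : g x @[x --> (0 : R)^'] --> (0 : R).
    have N : (`|h| : R) @[h --> (0 : R)^'] --> (0 : R).
      rewrite -[X in _ --> X](@normr0 _ R); apply: cvg_norm; apply: cvg_within_filter; exact: cvg_id.
    have E : {near (0 : R)^', (fun h : R => `|h|) =1 g}.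
      near=> h; have h0 : h != 0 by near: h; exact: nbhs_dnbhs_neq.
      by rewrite /g /= mul0r subr0 addr0 [_%:A]mulr1 [_ *: _]mulrA mulVf// mul1r.
    exact: (cvg_trans (near_eq_cvg E) N).
  split; first by apply/cvg_ex; exists 0.
  exact: cvg_lim L.
Unshelve. all: by end_near. Qed.

(** The square of the positive part of t, written so that its derivative t + |t| is one formula for
    all t. *)
Let p (t : R) : R := (t * t + t * `|t|) * 2^-1.

Let pE (t : R) : p t = if 0 <= t then t * t else 0.
Proof.
rewrite /p; case: ifPn => [t0|]; first by rewrite ger0_norm//; lra.
by rewrite -ltNge => t0; rewrite ltr0_norm//; lra.
Qed.

Let p_derive (t : R) : is_derive t 1 p (t + `|t|).
Proof.
have d1 := is_derive_mul (is_derive_id t 1) (is_derive_id t 1).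
apply: (is_derive_eq (is_derive_mulr 2^-1 (is_derive_add d1 (is_derive_mul_norm t)))).
by rewrite /= ; lra.
Qed.

Lemma smooth_step : exists h dh : R -> R,
  [/\ forall t : R, is_derive t 1 h (dh t), continuous dh,
      forall t, t <= 0 -> h t = 0, forall t, 1 <= t -> h t = 1
    & forall t, 0 <= h t <= 1].
Proof.
(* The step is p(t) / (p(t) + p(1 - t)); t and 1 - t are never both nonpositive, so the denominator
   is positive. *)
pose den t := p t + p (1 - t).
have p0 t : 0 <= p t by rewrite pE; case: ifP => // t0; rewrite mulr_ge0.
have den0 t : 0 < den t.
  rewrite /den !pE; have [t0|t0] := leP 0 t; have [t1|t1] := leP 0 (1 - t); nra.
have dp1 (t : R) : is_derive t 1 (fun t => p (1 - t)) (- (1 - t + `|1 - t|)).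
  have d1 : is_derive t 1 (fun t : R => 1 - t) (-1).
    by apply: (is_derive_eq (is_deriveB (is_derive_cst (1 : R) t 1) (is_derive_id t 1))); rewrite sub0r.
  by apply: (is_derive_eq (is_derive_comp d1 (p_derive (1 - t)))); ring.
pose dden (t : R) := t + `|t| + (- (1 - t + `|1 - t|)).
have dden_derive (t : R) : is_derive t 1 den (dden t) by exact: is_derive_add.
have dV (t : R) : is_derive t 1 (fun t => (den t)^-1) (- (den t)^-1 ^+ 2 * dden t).
  have [d2 d3] := dden_derive t; split; first by apply: derivableV => //; exact: lt0r_neq0.
  by rewrite deriveV ?lt0r_neq0// d3 /GRing.scale /= exprVn.
have cden : continuous den.
  by move=> t; have [/derivable1_diffP/differentiable_continuous] := dden_derive t.
have cp : continuous p.
  by move=> t; have [/derivable1_diffP/differentiable_continuous] := p_derive t.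
have cabs : continuous (fun t : R => t + `|t|).
  by move=> t; apply: cvgD; [exact: cvg_id|apply: cvg_norm; exact: cvg_id].
have cdden : continuous dden.
  move=> t; apply: cvgD; first exact: cabs.
  apply: cvgN; apply: (@continuous_comp _ _ _ (fun t : R => 1 - t) (fun t : R => t + `|t|)); last exact: cabs.
  by apply: cvgB; [exact: cvg_cst|exact: cvg_id].
have cV : continuous (fun t => (den t)^-1).
  by move=> t; apply: cvgV; [exact: lt0r_neq0|exact: cden].
exists (fun t => p t * (den t)^-1),
  (fun t => (t + `|t|) * (den t)^-1 + p t * (- (den t)^-1 ^+ 2 * dden t)).
split.
- by move=> t; exact: is_derive_mul.
- move=> t; apply: cvgD; first by apply: cvgM; [exact: cabs|exact: cV].
  apply: cvgM; [exact: cp|apply: cvgM; [|exact: cdden]].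
  by apply: cvgN; rewrite expr2; apply: cvgM; exact: cV.
- by move=> t t0; rewrite pE; case: ifPn => [t0'|_]; rewrite ?mul0r// (_ : t = 0) ?mulr0 ?mul0r//; lra.
- move=> t t1; have p10 : p (1 - t) = 0.
    by rewrite pE; case: ifPn => // t1'; rewrite (_ : t = 1) ?subrr ?mulr0//; lra.
  by have := den0 t; rewrite /den p10 addr0 => dn; rewrite divff// lt0r_neq0.
- move=> t; rewrite mulr_ge0 ?invr_ge0 ?(ltW (den0 _))//= ler_pdivrMr// mul1r lerDl.
  exact: p0.
Qed.

(** With m' = m + 1, the product h(m' t - 1) h(1 + m' (1 - t)) is 0 up to 1/m', 1 on [2/m', 1] and 0
    from 1 + 1/m' <= 2 on. The variable t will be |x|^2, so the limit is the indicator of the closed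
    unit ball without its centre. *)
Lemma smooth_cutoffs : exists theta dtheta : nat -> R -> R,
  [/\ forall m (t : R), is_derive t 1 (theta m) (dtheta m t),
      forall m, continuous (dtheta m),
      forall m t, t <= m.+1%:R^-1 \/ 2 <= t -> theta m t = 0,
      forall m t, `|theta m t| <= 1
    & forall t, theta m t @[m --> \oo] --> (((0 < t) && (t <= 1))%:R : R)].
Proof.
have [h [dh [hd cdh h0 h1 h01]]] := smooth_step.
pose a (m : nat) (t : R) := m.+1%:R * t - 1.
pose b (m : nat) (t : R) := 1 + m.+1%:R * (1 - t).
have da m (t : R) : is_derive t 1 (a m) m.+1%:R.
  have d1 := is_derive_mul (is_derive_cst (m.+1%:R : R) t 1) (is_derive_id t 1).
  by apply: (is_derive_eq (is_derive_add d1 (is_derive_cst (-1 : R) t 1))); rewrite /=; ring.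
have db m (t : R) : is_derive t 1 (b m) (- m.+1%:R).
  have d0 := is_deriveB (is_derive_cst (1 : R) t 1) (is_derive_id t 1).
  have d1 := is_derive_mul (is_derive_cst (m.+1%:R : R) t 1) d0.
  by apply: (is_derive_eq (is_derive_add (is_derive_cst (1 : R) t 1) d1)); rewrite /=; ring.
have ch : continuous h.
  by move=> t; have [/derivable1_diffP/differentiable_continuous] := hd t.
have ca m : continuous (a m).
  by move=> t; have [/derivable1_diffP/differentiable_continuous] := da m t.
have cb m : continuous (b m).
  by move=> t; have [/derivable1_diffP/differentiable_continuous] := db m t.
exists (fun m t => h (a m t) * h (b m t)),
  (fun m t => dh (a m t) * m.+1%:R * h (b m t) + h (a m t) * (dh (b m t) * - m.+1%:R)).
split.
- by move=> m t; apply: is_derive_mul; apply: is_derive_comp.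
- move=> m t; apply: cvgD; apply: cvgM.
  + by apply: cvgM; [apply: continuous_comp; [exact: ca|exact: cdh]|exact: cvg_cst].
  + by apply: continuous_comp; [exact: cb|exact: ch].
  + by apply: continuous_comp; [exact: ca|exact: ch].
  + by apply: cvgM; [apply: continuous_comp; [exact: cb|exact: cdh]|exact: cvg_cst].
- move=> m t [tm|t2].
    by rewrite h0 ?mul0r// /a subr_le0 mulrC -ler_pdivlMr// mul1r.
  rewrite [h (b m t)]h0 ?mulr0// /b.
  have : 1 <= m.+1%:R :> R by rewrite ler1n.
  by nra.
- move=> m t; rewrite normrM !ger0_norm; try by case/andP: (h01 (a m t)); case/andP: (h01 (b m t)).
  by case/andP: (h01 (a m t)); case/andP: (h01 (b m t)) => *; rewrite mulr_ile1.
- move=> t; have [t0|t0] /= := ltP 0 t; last first.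
    rewrite (_ : (fun _ => _) = cst 0); first exact: cvg_cst.
    by apply/funext => m; rewrite h0 ?mul0r// /a; have : 0 < m.+1%:R :> R by []; nra.
  have near_ge (c : R) : \forall m \near \oo, c <= m.+1%:R :> R.
    by near=> m; rewrite (le_trans (_ : c <= m%:R))// ?ler_nat//; near: m; exact: nbhs_infty_ger.
  have [t1|t1] /= := leP t 1.
    apply: cvg_near_cst; near=> m.
    have mt : 2 * t^-1 <= m.+1%:R by near: m; exact: near_ge.
    have m0 : 0 < m.+1%:R :> R by [].
    rewrite [h (a m t)]h1 ?[h (b m t)]h1 ?mulr1//; first by rewrite /b; nra.
    by move: mt; rewrite ler_pdivrMr// /a; lra.
  apply: cvg_near_cst; near=> m.
  have mt : (t - 1)^-1 <= m.+1%:R by near: m; exact: near_ge.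
  have t10 : 0 < t - 1 by lra.
  rewrite [h (b m t)]h0 ?mulr0//.
  by move: mt; rewrite -[X in X <= _]mul1r ler_pdivrMr// /b; lra.
Unshelve. all: by end_near. Qed.

Lemma integral_derive_compact_support (q dq : R -> R) :
  (forall t : R, is_derive t 1 q (dq t)) -> continuous dq ->
  (forall t, 2 <= `|t| -> q t = 0) -> (forall t, 2 < `|t| -> dq t = 0) ->
  (\int[@lebesgue_measure R]_t (dq t)%:E = 0)%E.
Proof.
move=> dqq cdq q0 dq0.
have -> : (\int[@lebesgue_measure R]_t (dq t)%:E =
    \int[@lebesgue_measure R]_(t in `[(-2)%R, 2%R]) (dq t)%:E)%E.
  rewrite [RHS]integral_mkcond; apply: eq_integral => t _; rewrite patchE.
  case: ifPn => //; rewrite notin_setE /= in_itv/= -ler_norml => /negP.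
  by rewrite -ltNge => /dq0 ->.
have cq : continuous q.
  by move=> t; have [/derivable1_diffP/differentiable_continuous] := dqq t.
rewrite (@continuous_FTC2 _ dq q)//.
- by rewrite !q0 ?subee// ?normrN ger0_norm.
- by lra.
- exact: continuous_subspaceT.
- split=> [t _||]; first by have [] := dqq t.
  + by apply: cvg_at_right_filter; exact: cq.
  + by apply: cvg_at_left_filter; exact: cq.
- by move=> t _; rewrite derive1E; have [] := dqq t.
Qed.

End cutoff.

(** * Divergence theorem on the sphere *)

Section sphere_calculus.
Context (R : realType) (n : nat).
Implicit Types (x w : 'rV[R]_n) (F : 'rV[R]_n -> R).

Lemma bounded_on_compact F (A : set 'rV[R]_n) : compact A ->
  (forall x, A x -> {for x, continuous F}) ->
  exists2 C, 0 <= C & forall x, A x -> `|F x| <= C.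
Proof.
move=> cA cF; have cFA : compact (F @` A).
  apply: continuous_compact => //; apply: continuous_in_subspaceT => x.
  by rewrite inE; exact: cF.
have [M [_ MF]] := compact_bounded cFA.
exists (`|M| + 1); first by rewrite addr_ge0.
by move=> x Ax; apply: MF; [rewrite ltr_pwDr// ler_norm|exists x].
Qed.

Lemma norm_le_coord x (a : R) : 0 <= a -> (forall i, `|x 0 i| <= a) -> `|x| <= a.
Proof.
move=> a0 xa; rewrite [leLHS]/Num.norm /= mx_normrE.
by apply: bigmax_le => // -[i j] _; rewrite ord1; exact: xa.
Qed.

Lemma sqr_coord_le_dot x i : x 0 i ^+ 2 <= dot x x.
Proof.
rewrite /dot (bigD1 i)//= -expr2 lerDl; apply: sumr_ge0 => j _.
by rewrite -expr2 sqr_ge0.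
Qed.

Lemma continuous_dotxx : continuous (fun x : 'rV[R]_n => dot x x).
Proof.
move=> x; apply: (partials_Ck_sum (k := 0) (U := setT) openT) => // i.
by apply: (partials_CkM (k := 0) openT); exact: (partials_Ck_coord openT 0).
Qed.

Lemma sphereE w : sphere w <-> dot w w = 1.
Proof.
split; first exact: dot_sphere.
by rewrite /sphere /= /enorm => ->; rewrite sqrtr1.
Qed.

Lemma closed_sphere : closed (@sphere R n).
Proof.
rewrite (_ : @sphere R n = (fun x => dot x x) @^-1` [set 1]).
  apply: preimage_closed; first by move=> x _; exact: continuous_dotxx.
  exact: closed_eq.
by apply/seteqP; split=> w /sphereE.
Qed.

Lemma compact_sphere : compact (@sphere R n).
Proof.
apply: bounded_closed_compact; last exact: closed_sphere.
exists 1; split; first exact: num_real.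
move=> M M1 w ws; apply: norm_le_coord => [|i]; first by rewrite (le_trans _ (ltW M1)).
by rewrite (le_trans _ (ltW M1))// coord_sphere_le1.
Qed.

Lemma compact_cube (a : R) : compact [set x : 'rV[R]_n | forall i, `|x 0 i| <= a].
Proof.
apply: bounded_closed_compact.
  exists `|a|; split; first exact: num_real.
  move=> M aM x xa; apply: norm_le_coord => [|i]; first by rewrite (le_trans _ (ltW aM)).
  by rewrite (le_trans (xa i))// (le_trans (ler_norm _))// ltW.
rewrite (_ : mkset _ = \bigcap_(i in setT) ((fun x : 'rV[R]_n => `|x 0 i|) @^-1` [set r | r <= a])).
  apply: closed_bigI => i _; apply: preimage_closed; last exact: closed_le.
  move=> x _; apply: (@continuous_comp _ _ _ (fun x : 'rV[R]_n => x 0 i) Num.norm).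
    exact: coord_continuous.
  exact: norm_continuous.
by apply/seteqP; split=> x xa i; [move=> _|]; exact: xa.
Qed.

Lemma sphere_Ck0_bounded (g : 'rV[R]_n -> R) : sphere_Ck 0 g ->
  exists2 C, 0 <= C & forall w, sphere w -> `|g w| <= C.
Proof.
move=> cg; have [|C C0 gC] := @bounded_on_compact (g \o @direction R n) _ compact_sphere.
  by move=> x /sphere_neq0; exact: cg.
by exists C => // w ws; rewrite -[w]direction_id//; exact: gC.
Qed.

Lemma partials_Ck_union k U V F : partials_Ck k U F -> partials_Ck k V F ->
  partials_Ck k (U `|` V) F.
Proof.
elim: k F => [|k IH] F /= CU CV; first by move=> x [/CU|/CV].
move=> i; have [dU CdU] := CU i; have [dV CdV] := CV i; split; last exact: IH.
by move=> x [/dU|/dV].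
Qed.

Lemma partials_C1_comp (U : set 'rV[R]_n) F (g dg : R -> R) : open U ->
  (forall t : R, is_derive t 1 g (dg t)) -> continuous dg ->
  partials_Ck 1 U F -> partials_Ck 1 U (fun x => g (F x)).
Proof.
move=> oU dgg cdg CF i; have [dF cdF] := CF i.
have dE x : U x -> is_derive x (delta_mx 0 i) (fun x => g (F x))
    (dg (F x) * 'D_(delta_mx 0 i) F x).
  by move=> Ux; apply: is_derive_comp; apply: derivableP; exact: dF.
split=> [x Ux|]; first exact: (ex_derive (is_derive := dE x Ux)).
apply: (@partials_Ck_congr _ _ _ oU 0 (fun x => dg (F x) * 'D_(delta_mx 0 i) F x)).
  by move=> x Ux; rewrite (derive_val (is_derive := dE x Ux)).
apply: partials_CkM => // x Ux.
by apply: continuous_comp; [exact: (partials_C1_continuous oU CF)|exact: cdg].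
Qed.

Lemma row_tuple_upd (t : n.-tuple (measurableTypeR R)) i (s : R) :
  (row_of_tuple (tuple_upd i t s) : 'rV[R]_n) =
  s *: delta_mx 0 i + (row_of_tuple (tuple_upd i t 0) : 'rV[R]_n).
Proof.
apply/rowP => j; rewrite !mxE !tnth_mktuple eqxx/=.
by case: eqVneq => _; rewrite ?mulr1 ?addr0 ?mulr0 ?add0r.
Qed.

(* The divergence of [W * (A \o direction)] with [W] radial is
   [W * div (A \o direction)], because [A] is tangential; [W] is cut off near 0
   and at infinity, so this divergence integrates to 0 along lines parallel to
   the axes. *)
Lemma integral_cutoff_sphere_div (theta dtheta : R -> R) (delta : R)
    (A : 'rV[R]_n -> 'rV[R]_n) : 0 < delta ->
  (forall t : R, is_derive t 1 theta (dtheta t)) -> continuous dtheta ->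
  (forall t, t <= delta \/ 2 <= t -> theta t = 0) ->
  (forall i, sphere_Ck 1 (fun x => A x 0 i)) ->
  (forall w, sphere w -> dot w (A w) = 0) ->
  (\int[lebesgue_tuple R n]_t (theta (dot (row_of_tuple t : 'rV[R]_n) (row_of_tuple t)) *
     sphere_div A (direction (row_of_tuple t)))%:E = 0)%E.
Proof.
move=> delta0 dth cdth th0 CA tA.
have oP := @open_punctured R n.
pose a i (x : 'rV[R]_n) := A (direction x) 0 i.
(* The divergence of A(x/|x|) has degree -1; the factor |x| turns it into the spherical divergence
   at x/|x|. *)
pose W (x : 'rV[R]_n) := theta (dot x x) * enorm x.
pose P i x := W x * a i x.
have enormE (x : 'rV[R]_n) : dot x x * (enorm x)^-1 = enorm x.
  have [->|x0] := eqVneq x 0; first by rewrite dot0r mul0r enorm0.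
  by rewrite -sqr_enorm expr2 mulfK// enorm_eq0.
have Csq : partials_Ck 1 (@punctured R n) (fun x => dot x x).
  apply: partials_Ck_sum => // i; apply: partials_CkM => //; exact: partials_Ck_coord.
have CW : partials_Ck 1 (@punctured R n) W.
  apply: (partials_CkM oP); first exact: partials_C1_comp Csq.
  apply: partials_Ck_congr (partials_CkM oP Csq (partials_Ck_inv_enorm _ n 1)) => // x _.
(* [direction] is discontinuous at 0, but the cutoff makes the field vanish on this neighbourhood of
   0, hence C^1 on the whole space. *)
pose N := [set x : 'rV[R]_n | dot x x < delta].
have oN : open N.
  apply: (@open_comp _ _ (fun x => dot x x) [set r | r < delta]); last exact: open_lt.
  by move=> x _; exact: continuous_dotxx.
have CP i : partials_Ck 1 setT (P i).
  rewrite (_ : setT = @punctured R n `|` N).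
    apply: partials_Ck_union; first exact: (partials_CkM oP CW (CA i)).
    apply: partials_Ck_congr (partials_Ck_cst oN 1 0) => // x Nx.
    by rewrite /P /W th0 ?mul0r//; left; exact: ltW.
  apply/seteqP; split=> // x _; have [->|x0] := eqVneq x 0; last by left.
  by right; rewrite /N /= dot0r.
pose M := [set x : 'rV[R]_n | 2 < dot x x].
have oM : open M.
  apply: (@open_comp _ _ (fun x => dot x x) [set r | 2 < r]); last exact: open_gt.
  by move=> x _; exact: continuous_dotxx.
have dP0 i (V : set 'rV[R]_n) x : open V -> V x -> (forall y, V y -> P i y = 0) ->
    'D_(delta_mx 0 i) (P i) x = 0.
  move=> oV Vx PV; rewrite -[RHS](derive_cst (0 : R) x (delta_mx 0 i)); apply: near_eq_derive.
  near=> y; apply: PV; near: y; exact: open_nbhs_nbhs.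
have dPM i x : M x -> 'D_(delta_mx 0 i) (P i) x = 0.
  move=> Mx; apply: (dP0 i M) => // y My.
  by rewrite /P /W th0 ?mul0r//; right; exact: ltW.
have cdP i : continuous ('D_(delta_mx 0 i) (P i)).
  by move=> x; exact: (CP i i).2.
have divE (x : 'rV[R]_n) : theta (dot x x) * sphere_div A (direction x) =
    \sum_i 'D_(delta_mx 0 i) (P i) x.
  have [->|x0] := eqVneq x 0.
    rewrite dot0r th0 ?mul0r; last by left; exact: ltW.
    rewrite big1// => i _; apply: (dP0 i N) => //; first by rewrite /N /= dot0r.
    by move=> y Ny; rewrite /P /W th0 ?mul0r//; left; exact: ltW.
  have e0 : enorm x != 0 by rewrite enorm_eq0.
  have ds := direction_sphere x0.
  (* grad W = om x is radial; it contributes om x . A(x/|x|), which is 0 by tangency. *)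
  pose om := dtheta (dot x x) * 2 * enorm x + theta (dot x x) * (enorm x)^-1.
  have dW i : is_derive x (delta_mx 0 i) W (x 0 i * om).
    have d1 := is_derive_comp (is_derive_sqnorm x (delta_mx 0 i)) (dth (dot x x)).
    have d2 := is_derive_mul (is_derive_sqnorm x (delta_mx 0 i)) (is_derive_inv_enorm (delta_mx 0 i) x0).
    rewrite [X in is_derive _ _ X](_ : _ = fun y =>
      theta (dot y y) * (dot y y * (enorm y)^-1)); last first.
      by apply/funext => y; rewrite enormE.
    apply: (is_derive_eq (is_derive_mul d1 d2)).
    rewrite (dotC x) dot_delta /om -sqr_enorm; field; exact: e0.
  have dPE i : 'D_(delta_mx 0 i) (P i) x =
      om * (x 0 i * a i x) + theta (dot x x) * 'D_(delta_mx 0 i) (a i) (direction x).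
    have da : is_derive x (delta_mx 0 i) (a i) ('D_(delta_mx 0 i) (a i) x).
      by apply: derivableP; exact: (CA i i).1.
    rewrite (derive_val (is_derive := is_derive_mul (dW i) da)).
    rewrite /W (@derive_homogeneous _ _ (fun x => A x 0 i) x)//.
      by rewrite /a /comp; field; exact: e0.
    by apply: (CA i i).1; exact: sphere_neq0.
  rewrite (eq_bigr _ (fun i _ => dPE i)) big_split/= -!mulr_sumr -[LHS]add0r.
  congr (_ + _); apply/esym.
  have -> : \sum_i x 0 i * a i x = dot x (A (direction x)) by [].
  by rewrite -{1}(enorm_direction x) dotZl tA ?mulr0.
pose g i t := 'D_(delta_mx 0 i) (P i) (@row_of_tuple R n t).
have mg i : measurable_fun setT (g i).
  have mD := continuous_measurable_rV openT (fun x _ => cdP i x).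
  exact: (measurableT_comp mD (@measurable_row_of_tuple R n)).
have bg i : bounded_support (g i).
  have [|C C0 gC] := bounded_on_compact (@compact_cube 2) (F := 'D_(delta_mx 0 i) (P i)).
    by move=> x _; exact: cdP.
  have out t j : 2 < `|tnth t j| -> g i t = 0.
    move=> tj; apply: dPM; rewrite /M /=.
    apply: lt_le_trans (sqr_coord_le_dot _ j); rewrite mxE -real_normK ?num_real//; nra.
  exists C, 2; split=> // t.
  have [/gC//|] := pselect (forall j, `|(row_of_tuple t : 'rV[R]_n) 0 j| <= 2).
  move=> /existsNP[j /negP]; rewrite -ltNge mxE => /out ->.
  by rewrite normr0.
under eq_integral do rewrite divE -sumEFin.
rewrite integral_sum//; last by move=> i; exact: (bounded_support_integrable (mg i) (bg i)).
apply: big1 => i _; apply: (@integral_lines0 R n i (g i)) => // t.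
set y : 'rV[R]_n := row_of_tuple (tuple_upd i t 0).
have yi : y 0 i = 0 by rewrite mxE tnth_mktuple eqxx.
under eq_integral do rewrite /g row_tuple_upd.
have out s : 2 <= `|s| -> 2 < dot (s *: delta_mx 0 i + y) (s *: delta_mx 0 i + y).
  move=> s2; apply: lt_le_trans (sqr_coord_le_dot _ i).
  by rewrite mxE yi addr0 !mxE !eqxx mulr1 -real_normK ?num_real//; nra.
apply: (@integral_derive_compact_support R (fun s => P i (s *: delta_mx 0 i + y))).
- by move=> s; apply: is_derive_line; apply: derivableP; exact: (CP i i).1.
- move=> s; apply: (@continuous_comp _ _ _ (fun s : R => s *: delta_mx 0 i + y)
    ('D_(delta_mx 0 i) (P i))); last exact: cdP.
  by apply: cvgD; [apply: cvgZr_tmp; exact: cvg_id|exact: cvg_cst].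
- by move=> s /out s2; rewrite /P /W th0 ?mul0r//; right; exact: ltW.
- by move=> s /ltW/out; exact: dPM.
Unshelve. all: by end_near. Qed.

End sphere_calculus.

(** * The uniform measure as an image of Lebesgue measure on the ball *)

Section uniform_sphere.
Import HBNNSimple.
Context (R : realType) (n : nat).
Local Notation T := (measurableTypeR R).
Local Notation Leb := (lebesgue_tuple R n).
Local Notation row := (@row_of_tuple R n).
Local Notation sigma := (@uniform_sphere R n).
Local Notation B := (@unit_ball R n).
Implicit Types (x w : 'rV[R]_n) (g : 'rV[R]_n -> R) (F : borel_rV R n -> \bar R).

Lemma measurable_sphere : measurable (@sphere R n : set (borel_rV R n)).
Proof. by apply: closed_measurable_rV; exact: closed_sphere. Qed.

Lemma sphere_Ck0_measurable g : sphere_Ck 0 g ->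
  measurable_fun (@sphere R n : set (borel_rV R n)) (g : borel_rV R n -> T).
Proof.
move=> cg; apply: (@eq_measurable_fun _ _ (borel_rV R n) T _ (g \o @direction R n)).
  by move=> w; rewrite inE => ws /=; rewrite direction_id.
apply: (@measurable_funS _ _ (borel_rV R n) T (@punctured R n)).
- by apply: open_measurable_rV; exact: open_punctured.
- by move=> w /sphere_neq0.
- by apply: continuous_measurable_rV; [exact: open_punctured|exact: cg].
Qed.

Lemma measurable_row_preimage (A : set (borel_rV R n)) : measurable A -> measurable (row @^-1` A).
Proof. by move=> mA; rewrite -[X in measurable X]setTI; exact: measurable_row_of_tuple. Qed.

Lemma unit_ballE : B = row @^-1` [set x : 'rV[R]_n | dot x x <= 1].
Proof.
apply/seteqP; split=> t /=; rewrite /unit_ball /= -sqr_enorm.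
  by move=> ?; rewrite expr_le1// enorm_ge0.
by rewrite expr_le1// enorm_ge0.
Qed.

Lemma measurable_unit_ball : measurable B.
Proof.
rewrite unit_ballE; apply: measurable_row_preimage; apply: closed_measurable_rV.
apply: (@preimage_closed _ _ (fun x : 'rV[R]_n => dot x x) [set r | r <= 1]); last exact: closed_le.
by move=> x _; exact: continuous_dotxx.
Qed.

Lemma continuous_direction x : x != 0 -> {for x, continuous (@direction R n)}.
Proof.
move=> x0; apply: (@cvgZ _ _ _ (nbhs x) (nbhs_filter x)
  (fun y : 'rV[R]_n => (enorm y)^-1) id); last exact: cvg_id.
exact: (partials_Ck_inv_enorm R n 0 x x0).
Qed.

Definition direction_row (t : n.-tuple T) : borel_rV R n := direction (row t).

(** [direction] is continuous only off 0, so the preimage of an open set is an open set, possibly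
    with the origin added. *)
Lemma measurable_direction_row : measurable_fun setT direction_row.
Proof.
apply: (@measurability _ _ _ _ setT direction_row (@open 'rV[R]_n)) => //.
move=> _ [U oU <-]; rewrite setTI.
have mP0 : measurable [set 0 : borel_rV R n].
  by apply: closed_measurable_rV; exact/accessible_closed_set1/hausdorff_accessible/norm_hausdorff.
pose V := [set x : 'rV[R]_n | x != 0 /\ U (direction x)].
have oV : open V.
  rewrite openE => x [x0 Ux]; have nP := near_punctured x0.
  have cD := continuous_direction x0.
  have nU : nbhs x (@direction R n @^-1` U) by apply: cD; exact: open_nbhs_nbhs.
  exact: filterI nP nU.
rewrite (_ : _ @^-1` U = row @^-1` (V `|` [set x | x = 0 /\ U 0])).
  apply: measurable_row_preimage; apply: measurableU; first exact: open_measurable_rV.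
  have [U0|U0] := pselect (U 0).
    by rewrite (_ : mkset _ = [set 0])//; apply/seteqP; split=> [x []|x ->].
  by rewrite (_ : mkset _ = set0)//; apply/seteqP; split=> [x []|x].
apply/seteqP; split=> t; rewrite /= /direction_row.
  have [->|t0] := eqVneq (row t : 'rV[R]_n) 0; last by left.
  by rewrite /direction scaler0; right.
by case=> [[]//|[-> U0]]; rewrite /direction scaler0.
Qed.

Lemma measurable_direction_preimage (A : set (borel_rV R n)) : measurable A ->
  measurable [set t : n.-tuple T | A (direction (row t))].
Proof. by move=> mA; rewrite -[X in measurable X]setTI; exact: measurable_direction_row. Qed.

Lemma lebesgue_open_gt0 (U : set 'rV[R]_n) x : open U -> U x -> (0 < Leb (row @^-1` U))%E.
Proof.
move=> oU Ux; have /nbhs_ballP[e /= e0 eU] : nbhs x U by exact: open_nbhs_nbhs.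
pose c k := if insub k is Some i then x 0 i else 0.
have e2 : 0 < e / 2 by rewrite divr_gt0.
apply: (@lt_le_trans _ _ (Leb (@cube R n c (e / 2)))).
  rewrite [ltRHS](_ : _ = ((2 * (e / 2)) ^+ n)%:E); last by apply: lebesgue_tuple_cube; exact: ltW.
  by rewrite lte_fin exprn_gt0// mulr_gt0.
apply: le_measure; rewrite ?inE.
- exact: measurable_cube.
- by apply: measurable_row_preimage; exact: open_measurable_rV.
- move=> t tc; apply: eU; split=> // i j; rewrite (ord1 i) mxE /ball/= distrC.
  have := tc j; rewrite /c valK => /le_lt_trans; apply.
  by rewrite ltr_pdivrMr// ltr_pMr// ltr1n.
Qed.

Lemma lebesgue_unit_ball_gt0 : (0 < Leb B)%E.
Proof.
have oU : open [set x : 'rV[R]_n | dot x x < 1].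
  apply: (@open_comp _ _ (fun x : 'rV[R]_n => dot x x) [set r | r < 1]); last exact: open_lt.
  by move=> x _; exact: continuous_dotxx.
apply: (lt_le_trans (@lebesgue_open_gt0 _ 0 oU _)); first by rewrite /= dot0r.
apply: le_measure; rewrite ?inE.
- by apply: measurable_row_preimage; exact: open_measurable_rV.
- exact: measurable_unit_ball.
- by rewrite unit_ballE => t /= /ltW.
Qed.

Lemma lebesgue_unit_ball_lty : (Leb B < +oo)%E.
Proof.
apply: (@le_lt_trans _ _ (Leb (@cube R n (fun=> 0) 1))).
  apply: le_measure; rewrite ?inE.
  - exact: measurable_unit_ball.
  - exact: measurable_cube.
  - rewrite unit_ballE => t /= t1 i; rewrite subr0.
    have := le_trans (sqr_coord_le_dot (row t) i) t1.
    by rewrite mxE -real_normK ?num_real// expr_le1.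
apply: le_lt_trans (ltry ((2 * 1) ^+ n)).
by rewrite -(@lebesgue_tuple_cube R n (fun=> 0)).
Qed.

Definition vol : R := fine (Leb B).

Lemma vol_gt0 : 0 < vol.
Proof. by rewrite fine_gt0// lebesgue_unit_ball_gt0 lebesgue_unit_ball_lty. Qed.

Lemma uniform_sphereE (A : set (borel_rV R n)) : measurable A ->
  sigma A = (Leb ([set t | A (direction (row t))] `&` B) * vol^-1%:E)%E.
Proof.
move=> mA; rewrite /uniform_sphere /= /mnormalize.
have E : @cone_measure R n setT = Leb B by rewrite /cone_measure setTI.
have E0 : (@cone_measure R n setT == 0)%E || (@cone_measure R n setT == +oo)%E = false.
  by rewrite E gt_eqF ?lebesgue_unit_ball_gt0//= lt_eqF ?lebesgue_unit_ball_lty.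
rewrite ifF; last exact: E0.
by congr (_ * (fine _)^-1%:E)%E; exact: E.
Qed.

(** Up to the factor 1 / [vol], the uniform measure is the image under [direction] of Lebesgue
    measure restricted to the ball. *)
Lemma ge0_integral_uniform_sphere F : measurable_fun setT F -> (forall w, 0 <= F w)%E ->
  (\int[sigma]_w F w = vol^-1%:E * \int[Leb]_(t in B) F (direction (row t)))%E.
Proof.
move=> mF F0; have v0 : 0 <= vol^-1 by rewrite invr_ge0 ltW// vol_gt0.
have mB := measurable_unit_ball.
have mphi := measurable_direction_row.
pose m := pushforward (mrestr Leb mB) direction_row.
rewrite (@eq_measure_integral _ _ _ setT (mscale (NngNum v0) m)); last first.
  move=> A mA _; rewrite [LHS]uniform_sphereE// muleC.
  by [].
rewrite ge0_integral_mscale//; congr (_ * _)%E.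
rewrite ge0_integral_pushforward//.
rewrite preimage_setT -(setUv B) ge0_integral_setU//.
- rewrite [X in (_ + X)%E](_ : _ = 0%E).
    rewrite adde0; apply: eq_measure_integral => A mA AB.
    by rewrite /= /mrestr (setIidl AB).
  apply: null_set_integral; first exact: measurableC.
    by apply: measurable_funTS; exact: measurableT_comp.
  by rewrite /= /mrestr setICl measure0.
- exact: measurableC.
- by apply: measurable_funTS; exact: measurableT_comp.
- by move=> t _; exact: F0.
- by apply/disj_setPCl.
Qed.

(** By homogeneity, |x| times the partial derivatives at x are those at x/|x|. *)
Lemma sphere_div_Ck0 (A : 'rV[R]_n -> 'rV[R]_n) :
  (forall i, sphere_Ck 1 (fun x => A x 0 i)) -> sphere_Ck 0 (sphere_div A).
Proof.
move=> CA; have oP := @open_punctured R n.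
pose D i := 'D_(delta_mx 0 i) (fun x => A (direction x) 0 i).
have CS : partials_Ck 0 (@punctured R n) (fun x => \sum_i enorm x * D i x).
  apply: partials_Ck_sum => // i; apply: partials_CkM => //; last exact: (CA i i).2.
  have Ce : partials_Ck 0 (@punctured R n) (fun x => (dot x x) * (enorm x)^-1).
    apply: partials_CkM => //; last exact: partials_Ck_inv_enorm.
    by move=> x _; exact: continuous_dotxx.
  apply: partials_Ck_congr Ce => // x x0.
  by rewrite -sqr_enorm expr2 mulfK// enorm_eq0.
apply: partials_Ck_congr CS => // x x0; apply: eq_bigr => i _ /=.
have xd : direction x != 0 by apply/sphere_neq0/direction_sphere.
rewrite /D (@derive_homogeneous _ _ (fun x => A x 0 i) x)//; last exact: (CA i i).1.
by rewrite mulrA mulfV ?mul1r// enorm_eq0.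
Qed.

Lemma bounded_support_ball (h : n.-tuple T -> R) (C : R) : 0 <= C ->
  (forall t, `|h t| <= C) -> (forall t, 2 < dot (row t : 'rV[R]_n) (row t) -> h t = 0) ->
  bounded_support h.
Proof.
move=> C0 hC h0; exists C, 2; split=> // t i ti; apply: h0.
apply: lt_le_trans (sqr_coord_le_dot _ i).
by rewrite mxE -real_normK ?num_real//; nra.
Qed.

Lemma divergence_theorem (A : 'rV[R]_n -> 'rV[R]_n) :
  (forall i, sphere_Ck 1 (fun x => A x 0 i)) ->
  (forall w, sphere w -> dot w (A w) = 0) ->
  (\int[sigma]_(w in @sphere R n) (sphere_div A w)%:E = 0)%E.
Proof.
move=> CA tA; have C0 := sphere_div_Ck0 CA; have mS := measurable_sphere.
have [C C_ge0 divC] := sphere_Ck0_bounded C0.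
have [theta [dtheta [dth cdth th0 th1 thl]]] := smooth_cutoffs R.
(* Extension by 0 gives a function that is measurable and bounded everywhere, and equal to 0 at the
   direction 0 of the origin. *)
pose g : borel_rV R n -> R := (sphere_div A : borel_rV R n -> R) \_ (@sphere R n).
have mg : measurable_fun setT (g : borel_rV R n -> T).
  by apply/(measurable_restrictT _ mS); exact: sphere_Ck0_measurable.
have gS w : sphere w -> g w = sphere_div A w by move=> ws; rewrite /g patchE mem_set.
have gC w : `|g w| <= C.
  rewrite /g patchE; case: ifPn => [|_]; first by rewrite inE; exact: divC.
  by rewrite normr0.
have g0 : g (0 : 'rV[R]_n) = 0.
  rewrite /g patchE; case: ifPn => //; rewrite inE => /sphere_neq0.
  by rewrite eqxx.
pose gd (t : n.-tuple T) : R := g (direction_row t).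
have mgd : measurable_fun setT gd by exact: (measurableT_comp mg measurable_direction_row).
pose h (m : nat) t := theta m (dot (row t : 'rV[R]_n) (row t)) * gd t.
have hE m t : h m t = theta m (dot (row t : 'rV[R]_n) (row t)) * sphere_div A (direction (row t)).
  rewrite /h /gd /direction_row; have [->|t0] := eqVneq (row t : 'rV[R]_n) 0.
    by rewrite dot0r th0 ?mul0r//; left.
  by rewrite gS//; exact: direction_sphere.
have int_h m : (\int[Leb]_t (h m t)%:E = 0)%E.
  under eq_integral do rewrite hE.
  apply: (@integral_cutoff_sphere_div R n (theta m) (dtheta m) m.+1%:R^-1) => //.
  exact: th0.
have mB := measurable_unit_ball.
have msq : measurable_fun setT (fun t : n.-tuple T => dot (row t : 'rV[R]_n) (row t)).
  have mD := continuous_measurable_rV openT (fun x _ => @continuous_dotxx R n x).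
  exact: (measurableT_comp mD (@measurable_row_of_tuple R n)).
have mth m : measurable_fun setT (fun t : n.-tuple T => theta m (dot (row t : 'rV[R]_n) (row t))).
  apply: (measurableT_comp _ msq); apply: continuous_measurable_fun => s.
  by have [/derivable1_diffP/differentiable_continuous] := dth m s.
have mh m : measurable_fun setT (h m) by exact: measurable_funM.
(* All cutoffs vanish for |x|^2 >= 2, so a single integrable function dominates the whole
   sequence. *)
pose dom := (cst C : n.-tuple T -> R) \_ [set t | dot (row t : 'rV[R]_n) (row t) <= 2].
have m2 : measurable [set t : n.-tuple T | dot (row t : 'rV[R]_n) (row t) <= 2].
  rewrite (_ : mkset _ = (fun t => dot (row t : 'rV[R]_n) (row t)) @^-1` [set` `]-oo, (2:R)]]).
    by rewrite -[X in measurable X]setTI; exact: msq.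
  by apply/seteqP; split=> t /=; rewrite in_itv.
have mdom : measurable_fun setT dom by apply/(measurable_restrictT _ m2).
have domE t : dom t = if dot (row t : 'rV[R]_n) (row t) <= 2 then C else 0.
  by rewrite /dom patchE; case: ifPn; [rewrite inE/= => ->|rewrite notin_setE/= => /negP/negPf->].
have idom : Leb.-integrable setT (EFin \o dom).
  apply: bounded_support_integrable => //; apply: (bounded_support_ball C_ge0) => t; rewrite domE.
    by case: ifP => _; rewrite ?normr0 ?ger0_norm.
  by rewrite ltNge => /negPf ->.
have h_dom m t : `|h m t| <= dom t.
  rewrite domE; case: ifPn => [_|]; last first.
    by rewrite -ltNge /h => /ltW t2; rewrite th0 ?mul0r ?normr0//; right.
  by rewrite /h -[C]mul1r normrM; apply: ler_pM => //; exact: gC.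
(* The limit of the cutoffs omits the centre of the ball, where [gd] is 0 anyway. *)
have lim_h t : (h m t)%:E @[m --> \oo] --> ((EFin \o gd) \_ B) t.
  have -> : ((EFin \o gd) \_ B) t =
      ((((0 < dot (row t : 'rV[R]_n) (row t)) && (dot (row t : 'rV[R]_n) (row t) <= 1))%:R : R) * gd t)%:E.
    rewrite patchE unit_ballE; case: ifPn; [rewrite inE/= => ->|rewrite notin_setE/= => /negP/negPf->].
      rewrite andbT; case: ltP => [_|t0]; first by rewrite mul1r.
      rewrite /gd /direction_row mul0r (_ : row t = 0 :> 'rV[R]_n); last first.
        by apply/eqP; rewrite -dotxx_eq0 eq_le t0 dotxx_ge0.
      by rewrite /direction scaler0 g0.
    by rewrite andbF mul0r.
  by apply: cvg_EFin; [exact: nearW|apply: cvgM; [exact: thl|exact: cvg_cst]].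
have [|||||igd _ L] := @dominated_convergence _ _ _ Leb setT measurableT
    (fun m => EFin \o h m) ((EFin \o gd) \_ B) (EFin \o dom).
- by move=> m; exact/measurable_EFinP.
- by apply/(measurable_restrictT _ mB); apply: measurable_funTS; exact/measurable_EFinP.
- by apply: aeW => t _; exact: lim_h.
- exact: idom.
- by apply: aeW => t m _; rewrite /= lee_fin.
have {L} int_gd : (\int[Leb]_(t in B) (gd t)%:E = 0)%E.
  move: L; rewrite (_ : [sequence _]_m = cst 0%E); last by apply/funext => m; exact: int_h.
  by move=> /cvg_lim L; rewrite integral_mkcond -L// lim_cst.
have {}igd : Leb.-integrable B (EFin \o gd) by apply/(integrable_mkcond _ mB).
have mEg : measurable_fun setT (EFin \o g) by exact/measurable_EFinP.
rewrite integral_mkcond (_ : _ \_ _ = EFin \o g); last by rewrite -restrict_EFin.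
(* The transfer to the ball is stated for nonnegative functions, so positive and negative parts are
   moved separately; both are finite, and they are equal because the integral over the ball is 0. *)
rewrite integralE !ge0_integral_uniform_sphere//; [|exact: measurable_funeneg|exact: measurable_funepos].
have ap := integrable_pos_fin_num mB igd; have an := integrable_neg_fin_num mB igd.
have ab : (\int[Leb]_(t in B) (EFin \o gd)^\+ t = \int[Leb]_(t in B) (EFin \o gd)^\- t)%E.
  apply/eqP; rewrite -[eqbRHS]add0e -sube_eq ?fin_num_adde_defl//.
  by apply/eqP; rewrite -integralE.
transitivity (vol^-1%:E * (\int[Leb]_(t in B) (EFin \o gd)^\+ t) -
  vol^-1%:E * (\int[Leb]_(t in B) (EFin \o gd)^\- t))%E.
  by congr (_ * _ - _ * _)%E; apply: eq_integral => t _; rewrite ?funeposE ?funenegE.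
by rewrite ab subee// fin_numM.
Qed.

(* No measurability of [g] is assumed: a simple function below [g] suffices. *)
Lemma integral_sphere_gt0 g w0 (eps : R) : (forall w, sphere w -> 0 <= g w) ->
  0 < eps -> sphere w0 -> (\forall w \near w0, sphere w -> eps <= g w) ->
  (0 < \int[sigma]_(w in @sphere R n) (g w)%:E)%E.
Proof.
move=> g0 eps0 w0s Ng; have : nbhs w0 [set w | sphere w -> eps <= g w] by [].
rewrite nbhsE => -[U [oU Uw0] Ug].
have mA : measurable (U `&` @sphere R n : set (borel_rV R n)).
  by apply: measurableI; [exact: open_measurable_rV|exact: measurable_sphere].
pose A : set (borel_rV R n) := U `&` @sphere R n.
have sA : (0 < sigma A)%E.
  rewrite uniform_sphereE// mule_gt0//; last by rewrite lte_fin invr_gt0 vol_gt0.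
  (* The open cone over U inside the open ball; it contains w0 / 2, hence a small cube. *)
  pose V := [set x : 'rV[R]_n | (x != 0 /\ U (direction x)) /\ dot x x < 1].
  have oV : open V.
    rewrite openE => x [[x0 Ux] x1]; have nP := near_punctured x0.
    have cD := continuous_direction x0.
    have nU : nbhs x (@direction R n @^-1` U) by apply: cD; exact: open_nbhs_nbhs.
    have n1 : nbhs x [set y | dot y y < 1].
      by apply: (@continuous_dotxx R n x [set r | r < 1]); exact: open_nbhs_nbhs (conj (@open_lt _ _) x1).
    exact: filterI (filterI nP nU) n1.
  have Vw : V (2^-1 *: w0).
    have w00 := sphere_neq0 w0s.
    split; last by rewrite dotZl dotZr dot_sphere// mulr1; lra.
    by rewrite scaler_eq0 negb_or w00 andbT invr_eq0 directionZ// direction_id.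
  apply: (lt_le_trans (lebesgue_open_gt0 oV Vw)); apply: le_measure; rewrite ?inE.
  - by apply: measurable_row_preimage; exact: open_measurable_rV.
  - by apply: measurableI; [exact: measurable_direction_preimage|exact: measurable_unit_ball].
  - move=> t [[t0 Ut] t1]; split; first by split=> //; exact: direction_sphere.
    by rewrite unit_ballE /=; exact: ltW.
rewrite integral_mkcond ge0_integralTE; last first.
  by move=> w; rewrite patchE; case: ifPn => //; rewrite inE => /g0; rewrite lee_fin.
apply: (@lt_le_trans _ _ (sintegral sigma (scale_nnsfun (indic_nnsfun R mA) (ltW eps0)))).
  rewrite [ltRHS](_ : _ = eps%:E * sigma A)%E ?mule_gt0 ?lte_fin//.
  rewrite (_ : sintegral _ _ = eps%:E * sintegral sigma (indic_nnsfun R mA))%E.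
    by congr (_ * _)%E; exact: sintegral_indic.
  by rewrite -sintegralrM.
apply: ereal_sup_ubound; exists (scale_nnsfun (indic_nnsfun R mA) (ltW eps0)) => //= w.
rewrite patchE /= /mindic indicE; case: ifPn => [|wS].
  rewrite inE => ws; rewrite lee_fin; have [|_] := boolP (w \in _); rewrite ?mulr0 ?mulr1; last exact: g0.
  by rewrite inE => -[Uw _]; exact: Ug.
by rewrite memNset ?mulr0// => -[_ ws]; move: wS; rewrite mem_set.
Qed.

End uniform_sphere.

(** * Moments and the flux of von Mises distributions *)

Section exponential_moments.
Context d (T : measurableType d) (R : realType) (mu : {measure set T -> \bar R}).
Variables (D : set T) (mD : measurable D).
Hypothesis muD : (mu D < +oo)%E.
Implicit Types X Y f : T -> R.

Lemma bounded_integrable f (C : R) : measurable_fun D f ->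
  (forall x, D x -> `|f x| <= C) -> mu.-integrable D (EFin \o f).
Proof.
move=> mf fC; apply: measurable_bounded_integrable => //.
exists C; split=> [|M CM x Dx]; [exact: num_real|exact: le_trans (fC _ Dx) (ltW CM)].
Qed.

Lemma Rintegral_sum (I : Type) (r : seq I) (h : I -> T -> R) :
  (forall i, mu.-integrable D (EFin \o h i)) ->
  mu.-integrable D (EFin \o (fun x => \sum_(i <- r) h i x)) /\
  \int[mu]_(x in D) (\sum_(i <- r) h i x) = \sum_(i <- r) \int[mu]_(x in D) h i x.
Proof.
move=> ih; elim: r => [|i r [IH1 IH2]].
  split; last by rewrite big_nil; under eq_Rintegral do rewrite big_nil; rewrite Rintegral_cst ?mul0r.
  by under eq_fun do rewrite big_nil; exact: integrable0.
split; last by rewrite big_cons -IH2 -RintegralD//; under eq_Rintegral do rewrite big_cons.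
under eq_fun do rewrite big_cons.
by have := integrableD mD (ih i) IH1; apply: eq_integrable.
Qed.

(** Termwise integration of the exponential series. [X] will be w . Omega or the cosine, and [Y] a
    weight: 1 or a coordinate on the sphere, a product of cosine and sine powers on the interval. *)
Lemma integral_exp_moments X Y (kappa : R) :
  measurable_fun D X -> measurable_fun D Y ->
  (forall x, D x -> `|X x| <= 1) -> (forall x, D x -> `|Y x| <= 1) ->
  (\sum_(0 <= k < N) (kappa ^+ k / k`!%:R * \int[mu]_(x in D) (Y x * X x ^+ k)))
    @[N --> \oo] --> \int[mu]_(x in D) (Y x * expR (kappa * X x)).
Proof.
move=> mX mY X1 Y1.
pose F (N : nat) x := \sum_(0 <= k < N) (kappa ^+ k / k`!%:R * (Y x * X x ^+ k)).
have mXk k : measurable_fun D (fun x => Y x * X x ^+ k).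
  by apply: measurable_funM => //; exact: measurable_funX.
have iXk k : mu.-integrable D (EFin \o (fun x => Y x * X x ^+ k)).
  apply: (@bounded_integrable _ 1) => // x Dx; rewrite normrM normrX.
  by rewrite mulr_ile1 ?exprn_ge0 ?exprn_ile1 ?X1 ?Y1.
have iZ k : mu.-integrable D (EFin \o (fun x => kappa ^+ k / k`!%:R * (Y x * X x ^+ k))).
  have := integrableZl mD (kappa ^+ k / k`!%:R) (iXk k); exact: eq_integrable.
have FE N x : F N x = Y x * series (exp_coeff (kappa * X x)) N.
  rewrite /F /series/= mulr_sumr; apply: eq_bigr => k _.
  by rewrite /exp_coeff /= exprMn; ring.
have sumE N : \sum_(0 <= k < N) (kappa ^+ k / k`!%:R * \int[mu]_(x in D) (Y x * X x ^+ k)) =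
    \int[mu]_(x in D) F N x.
  rewrite /F (Rintegral_sum _ _).2//; apply: eq_bigr => k _.
  by rewrite RintegralZl.
have iF N : mu.-integrable D (EFin \o F N) by exact: (Rintegral_sum _ iZ).1.
(* As |X| <= 1, the partial sums are bounded by those of the series at |kappa|, which increase to
   their limit. *)
have series_le N x : D x -> `|series (exp_coeff (kappa * X x)) N| <= expR `|kappa|.
  move=> Dx; apply: (@le_trans _ _ (series (exp_coeff `|kappa|) N)).
    rewrite /series /= (le_trans (ler_norm_sum _ _ _))//; apply: ler_sum => k _.
    rewrite /exp_coeff /= normrM normrX normfV [ `|k`!%:R| ]ger0_norm// ler_wpM2r ?invr_ge0//.
    by rewrite lerXn2r ?nnegrE// normrM ler_piMr// X1.
  apply: nondecreasing_cvgn_le; last exact: is_cvg_series_exp_coeff.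
  by apply: nondecreasing_series => k _ _; rewrite exp_coeff_ge0.
have mE : measurable_fun D (fun x => Y x * expR (kappa * X x)).
  apply: measurable_funM => //; apply: measurableT_comp => //.
  by apply: measurable_funM.
have Fcvg x : F N x @[N --> \oo] --> Y x * expR (kappa * X x).
  under eq_fun do rewrite FE; apply: cvgM; first exact: cvg_cst.
  exact: is_cvg_series_exp_coeff.
have [|||||iE _ L] := @dominated_convergence _ _ _ mu D mD (fun N => EFin \o F N)
   (EFin \o (fun x => Y x * expR (kappa * X x))) (cst (expR `|kappa|)%:E).
- by move=> N; exact: measurable_int (iF N).
- exact/measurable_EFinP.
- by apply: aeW => x _; apply: cvg_EFin; [exact: nearW|exact: Fcvg].
- apply: (@bounded_integrable (cst (expR `|kappa|)) (expR `|kappa|)) => // x _.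
  by rewrite ger0_norm// expR_ge0.
- apply: aeW => x N Dx; rewrite /= lee_fin FE normrM -[leRHS]mul1r ler_pM ?Y1//.
  exact: series_le.
under eq_fun do rewrite sumE.
apply: (fine_cvg (f := fun N => \int[mu]_(x in D) (F N x)%:E)%E).
rewrite fineK; first exact: L.
exact: integrable_fin_num.
Qed.

End exponential_moments.

(** Both sides are limits of the same partial sums. The factors [a] and [b] express proportionality
    of the moments without division. *)
Lemma integral_exp_eq_moments d1 d2 (T1 : measurableType d1) (T2 : measurableType d2)
    (R : realType) (mu1 : {measure set T1 -> \bar R}) (mu2 : {measure set T2 -> \bar R})
    (D1 : set T1) (D2 : set T2) (X1 Y1 : T1 -> R) (X2 Y2 : T2 -> R) (a b kappa : R) :
  measurable D1 -> measurable D2 -> (mu1 D1 < +oo)%E -> (mu2 D2 < +oo)%E ->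
  measurable_fun D1 X1 -> measurable_fun D1 Y1 ->
  measurable_fun D2 X2 -> measurable_fun D2 Y2 ->
  (forall x, D1 x -> `|X1 x| <= 1) -> (forall x, D1 x -> `|Y1 x| <= 1) ->
  (forall x, D2 x -> `|X2 x| <= 1) -> (forall x, D2 x -> `|Y2 x| <= 1) ->
  (forall k, \int[mu1]_(x in D1) (Y1 x * X1 x ^+ k) * a =
             \int[mu2]_(x in D2) (Y2 x * X2 x ^+ k) * b) ->
  \int[mu1]_(x in D1) (Y1 x * expR (kappa * X1 x)) * a =
  \int[mu2]_(x in D2) (Y2 x * expR (kappa * X2 x)) * b.
Proof.
move=> mD1 mD2 D1oo D2oo mX1 mY1 mX2 mY2 bX1 bY1 bX2 bY2 E.
pose S1 (N : nat) := (\sum_(0 <= k < N)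
  (kappa ^+ k / k`!%:R * \int[mu1]_(x in D1) (Y1 x * X1 x ^+ k))) * a.
have L1 : S1 @ \oo --> \int[mu1]_(x in D1) (Y1 x * expR (kappa * X1 x)) * a.
  by apply: cvgM; [exact: integral_exp_moments|exact: cvg_cst].
have L2 : S1 @ \oo --> \int[mu2]_(x in D2) (Y2 x * expR (kappa * X2 x)) * b.
  rewrite (_ : S1 = fun N => (\sum_(0 <= k < N) (kappa ^+ k / k`!%:R *
      \int[mu2]_(x in D2) (Y2 x * X2 x ^+ k))) * b).
    by apply: cvgM; [exact: integral_exp_moments|exact: cvg_cst].
  apply/funext => N; rewrite /S1 !mulr_suml; apply: eq_bigr => k _.
  by rewrite -!mulrA E.
by rewrite -(cvg_lim _ L1)// (cvg_lim _ L2).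
Qed.

(** * Moments of the cosine with weight sin^N *)

Section cosine_moments.
Context (R : realType) (N : nat).
Local Notation mu := (@lebesgue_measure R).
Local Notation I0pi := (`[0, pi]%classic : set R).

Let mI : measurable (I0pi : set (measurableTypeR R)). Proof. exact: measurable_itv. Qed.

Lemma lebesgue_0pi_lty : (mu I0pi < +oo)%E.
Proof. by rewrite lebesgue_measure_itv/= lte_fin pi_gt0 -EFinB ltry. Qed.

Let int_bounded (f : R -> R) (C : R) : continuous f -> (forall x, `|f x| <= C) ->
  mu.-integrable I0pi (EFin \o f).
Proof.
move=> cf fC; apply: (@bounded_integrable _ _ R mu I0pi mI lebesgue_0pi_lty f C) => //.
by apply: measurable_funTS; exact: continuous_measurable_fun.
Qed.

Definition cos_moment (k : nat) : R := \int[mu]_(t in I0pi) (cos t ^+ k * sin t ^+ N).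

Let cX k : continuous (fun t : R => cos t ^+ k).
Proof.
by move=> t; apply: (@continuous_comp _ _ _ (@cos R) (fun x => x ^+ k));
  [exact: continuous_cos|exact: exprn_continuous].
Qed.

Let sX k : continuous (fun t : R => sin t ^+ k).
Proof.
by move=> t; apply: (@continuous_comp _ _ _ (@sin R) (fun x => x ^+ k));
  [exact: continuous_sin|exact: exprn_continuous].
Qed.

Let cos_le1 (t : R) : `|cos t| <= 1.
Proof. by rewrite ler_norml cos_geN1 cos_le1. Qed.

Let sin_le1 (t : R) : `|sin t| <= 1.
Proof. by rewrite ler_norml sin_geN1 sin_le1. Qed.

Lemma integrable_cos_moment k p :
  mu.-integrable I0pi (EFin \o (fun t => cos t ^+ k * sin t ^+ p)).
Proof.
apply: (@int_bounded _ 1); first by move=> t; apply: cvgM; [exact: cX|exact: sX].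
by move=> t; rewrite normrM !normrX mulr_ile1 ?exprn_ge0 ?exprn_ile1.
Qed.

(** The integrand is the derivative of cos^k sin^(N+1), which vanishes at 0 and pi. For k = 0 the
    truncated exponent [k.-1] comes with coefficient 0. *)
Let FTC (k : nat) : \int[mu]_(t in I0pi)
    (N.+1%:R * (cos t ^+ k.+1 * sin t ^+ N) - k%:R * (cos t ^+ k.-1 * sin t ^+ N.+2)) = 0.
Proof.
pose dF (t : R) := N.+1%:R * (cos t ^+ k.+1 * sin t ^+ N) - k%:R * (cos t ^+ k.-1 * sin t ^+ N.+2).
pose F (t : R) := cos t ^+ k * sin t ^+ N.+1.
have dFF (t : R) : is_derive t 1 F (dF t).
  have d1 : is_derive t 1 (fun t : R => cos t ^+ k) (k%:R * cos t ^+ k.-1 * - sin t).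
    rewrite (_ : (fun _ => _) = (@cos R) ^+ k); last by apply/funext => x; rewrite exprfctE.
    exact: is_deriveX.
  have d2 : is_derive t 1 (fun t : R => sin t ^+ N.+1) (N.+1%:R * sin t ^+ N * cos t).
    rewrite (_ : (fun _ => _) = (@sin R) ^+ N.+1); last by apply/funext => x; rewrite exprfctE.
    exact: is_deriveX.
  apply: (is_derive_eq (is_derive_mul d1 d2)); rewrite /dF !exprS; ring.
have cF t : {for t, continuous F}.
  by have [/derivable1_diffP/differentiable_continuous] := dFF t.
rewrite /Rintegral (@continuous_FTC2 _ dF F 0 pi) ?pi_gt0//.
- by rewrite /F sinpi sin0 !exprS !mul0r !mulr0 subee.
- apply: continuous_subspaceT => t; rewrite /dF; apply: cvgB.
    by apply: cvgM; [exact: cvg_cst|apply: cvgM; [exact: cX|exact: sX]].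
  by apply: cvgM; [exact: cvg_cst|apply: cvgM; [exact: cX|exact: sX]].
- split=> [t _||]; first by have [] := dFF t.
    by apply: cvg_at_right_filter; exact: cF.
  by apply: cvg_at_left_filter; exact: cF.
- by move=> t _; rewrite derive1E; have [] := dFF t.
Qed.

Lemma cos_moment_sin2 k :
  \int[mu]_(t in I0pi) (cos t ^+ k * sin t ^+ N.+2) = cos_moment k - cos_moment k.+2.
Proof.
rewrite /cos_moment -RintegralB//; try exact: integrable_cos_moment.
apply: eq_Rintegral => t _; have cs := cos2Dsin2 t.
rewrite (_ : cos t ^+ k.+2 = cos t ^+ k * cos t ^+ 2); last by rewrite -exprD addn2.
rewrite (_ : sin t ^+ N.+2 = sin t ^+ N * sin t ^+ 2); last by rewrite -exprD addn2.
have -> : sin t ^+ 2 = 1 - cos t ^+ 2 by lra.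
by ring.
Qed.

(** Replacing sin^2 by 1 - cos^2 in the previous identity leaves only the weight sin^N. *)
Lemma cos_moment_rec k : (N.+1 + k)%:R * cos_moment k.+1 = k%:R * cos_moment k.-1.
Proof.
have iZ c m p : mu.-integrable I0pi (EFin \o (fun t => c * (cos t ^+ m * sin t ^+ p))).
  by have := integrableZl mI c (integrable_cos_moment m p); apply: eq_integrable.
have := FTC k; rewrite RintegralB//.
rewrite !RintegralZl//; try exact: integrable_cos_moment.
case: k => [|k]; first by rewrite !mul0r subr0 addn0.
by rewrite cos_moment_sin2 -/(cos_moment k.+2) /= natrD => H; lra.
Qed.

End cosine_moments.

(** Wallis' reduction: the integral of sin^(N+2) is (N+1)/(N+2) times that of sin^N, so the cases N
    = 0 and N = 1 suffice. *)
Lemma cos_moment0_gt0 (R : realType) N : 0 < cos_moment R N 0.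
Proof.
have [W0 W1] : 0 < cos_moment R 0 0 /\ 0 < cos_moment R 1 0.
  split.
    rewrite /cos_moment (_ : Rintegral _ _ _ = \int[lebesgue_measure]_(t in `[0, pi]) cst 1 t); last first.
      by apply: eq_Rintegral => t _; rewrite !expr0 mulr1.
    have mpi : @lebesgue_measure R `[0, pi]%classic = pi%:E.
      by rewrite lebesgue_measure_itv/= lte_fin pi_gt0 -EFinB subr0.
    rewrite Rintegral_cst// mul1r; apply: (lt_le_trans (pi_gt0 R)).
    by rewrite -[leLHS]/(fine pi%:E) -mpi.
  rewrite /cos_moment /Rintegral (@continuous_FTC2 _ _ (fun t => - cos t) 0 pi) ?pi_gt0//=.
  - by rewrite cospi cos0; lra.
  - apply: continuous_subspaceT => t.
    apply: (@continuous_comp _ _ _ (@sin R) (fun x => cos t ^+ 0 * x ^+ 1)); first exact: continuous_sin.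
    by apply: cvgM; [exact: cvg_cst|exact: exprn_continuous].
  - split=> [t _||].
    + by apply: derivableN; exact: ex_derive.
    + by apply: cvg_at_right_filter; apply: cvgN; exact: continuous_cos.
    + by apply: cvg_at_left_filter; apply: cvgN; exact: continuous_cos.
  - move=> t _; rewrite derive1E deriveN; last exact: ex_derive.
    by rewrite derive_val opprK expr0 mul1r expr1.
have step M : 0 < cos_moment R M 0 -> 0 < cos_moment R M.+2 0.
  move=> WM; have := cos_moment_rec R M 1; have := cos_moment_sin2 R M 0.
  rewrite /= natrD mul1r -/(cos_moment R M.+2 0) => -> E.
  have M0 : 0 <= M%:R :> R by [].
  have M1 : M.+1%:R = M%:R + 1 :> R by rewrite -addn1 natrD.
  by rewrite M1 in E; nra.
suff : 0 < cos_moment R N 0 /\ 0 < cos_moment R N.+1 0 by case.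
by elim: N => [//|N [H1 H2]]; split=> //; exact: step.
Qed.

(** * Differential calculus on the sphere *)

Section sphere_Ck_closure.
Context (R : realType) (n : nat).
Implicit Types (f g : 'rV[R]_n -> R) (w v : 'rV[R]_n).
Let oP := @open_punctured R n.

Lemma sphere_CkW k f : sphere_Ck k.+1 f -> sphere_Ck k f.
Proof. exact: partials_CkW. Qed.

Lemma sphere_Ck_congr k f g : (forall w, sphere w -> f w = g w) -> sphere_Ck k f -> sphere_Ck k g.
Proof.
by move=> fg; apply: partials_Ck_congr => // x x0; apply: fg; exact: direction_sphere.
Qed.

Lemma sphere_CkM k f g : sphere_Ck k f -> sphere_Ck k g -> sphere_Ck k (fun x => f x * g x).
Proof. exact: partials_CkM. Qed.

Lemma sphere_CkD k f g : sphere_Ck k f -> sphere_Ck k g -> sphere_Ck k (fun x => f x + g x).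
Proof. exact: partials_CkD. Qed.

Lemma sphere_Ck_cst k (c : R) : sphere_Ck k (fun _ : 'rV[R]_n => c).
Proof. exact: partials_Ck_cst. Qed.

Lemma sphere_CkB k f g : sphere_Ck k f -> sphere_Ck k g -> sphere_Ck k (fun x => f x - g x).
Proof.
move=> Cf Cg; apply: sphere_Ck_congr (sphere_CkD Cf (sphere_CkM (sphere_Ck_cst k (-1)) Cg)).
by move=> w _; rewrite mulN1r.
Qed.

Lemma sphere_CkX k f m : sphere_Ck k f -> sphere_Ck k (fun x => f x ^+ m).
Proof. exact: partials_CkX. Qed.

Lemma sphere_Ck_expR k f : sphere_Ck k f -> sphere_Ck k (fun x => expR (f x)).
Proof. exact: partials_Ck_expR. Qed.

Lemma sphere_Ck_coord k i : sphere_Ck k (fun x : 'rV[R]_n => x 0 i).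
Proof. exact: partials_Ck_direction. Qed.

Lemma sphere_Ck_dot k v : sphere_Ck k (fun x => dot x v).
Proof. exact: partials_Ck_dot_direction. Qed.

Lemma sphere_Ck_tangent_proj k v i : sphere_Ck k (fun x => tangent_proj x v 0 i).
Proof.
apply: sphere_Ck_congr (sphere_CkB (sphere_Ck_cst k (v 0 i))
  (sphere_CkM (sphere_Ck_dot k v) (sphere_Ck_coord k i))).
by move=> w _; rewrite tangent_projE.
Qed.

Lemma sphere_integrable g : sphere_Ck 0 g ->
  (@uniform_sphere R n).-integrable (@sphere R n) (EFin \o g).
Proof.
move=> cg; have [C C0 gC] := sphere_Ck0_bounded cg.
apply: (@bounded_integrable _ _ R (@uniform_sphere R n) _ (@measurable_sphere R n) _ _ C) => //.
  by rewrite (le_lt_trans (probability_le1 _ (@measurable_sphere R n)))// ltry.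
exact: sphere_Ck0_measurable.
Qed.

Lemma derivable_sphere_Ck1 f w i : sphere_Ck 1 f -> w != 0 ->
  derivable (f \o @direction R n) w (delta_mx 0 i).
Proof. by move=> Cf; exact: (Cf i).1. Qed.

Lemma is_derive_sphere_grad f w i : sphere_Ck 1 f -> w != 0 ->
  is_derive w (delta_mx 0 i) (f \o @direction R n) (sphere_grad f w 0 i).
Proof. by move=> Cf w0; rewrite mxE; apply: derivableP; exact: derivable_sphere_Ck1. Qed.

Lemma is_derive_sphere_dot w v i : sphere w ->
  is_derive w (delta_mx 0 i) (fun x => dot (direction x) v) (tangent_proj w v 0 i).
Proof.
move=> ws; have := is_derive_dot_direction (delta_mx 0 i) v (sphere_neq0 ws).
by rewrite direction_id// dot_delta ws invr1 mul1r.
Qed.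

Lemma is_derive_sphere_coord w i j : sphere w ->
  is_derive w (delta_mx 0 i) (fun x => direction x 0 j) (tangent_proj w (delta_mx 0 i) 0 j).
Proof.
move=> ws; have := is_derive_direction (delta_mx 0 i) j (sphere_neq0 ws).
by rewrite direction_id// ws invr1 mul1r.
Qed.

Lemma is_derive_sphere_tangent_proj w v i : sphere w ->
  is_derive w (delta_mx 0 i) (fun x => tangent_proj (direction x) v 0 i)
   (- (tangent_proj w v 0 i * w 0 i + dot w v * (1 - w 0 i ^+ 2))).
Proof.
move=> ws.
have d1 := is_derive_mul (is_derive_sphere_dot v i ws) (is_derive_sphere_coord i i ws).
have d2 := is_derive_add (is_derive_cst (v 0 i) w (delta_mx 0 i)) (is_derive_mulr (-1) d1).
rewrite (_ : (fun x => tangent_proj _ _ _ _) = fun y => v 0 i + dot (direction y) v * direction y 0 i * -1).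
  by apply: (is_derive_eq d2); rewrite direction_id//
    [tangent_proj _ (delta_mx 0 i) 0 i]tangent_projE [dot w (delta_mx 0 i)]dotC dot_delta
    !mxE !eqxx expr2 /=; ring.
by apply/funext => x; rewrite tangent_projE mulrN1.
Qed.

(** Product rule together with div P_{w^perp} v = - (n - 1) w . v; the n - 1 is the sum of the 1 -
    w_i^2. *)
Lemma sphere_div_tangent_proj g v w : sphere_Ck 1 g -> sphere w ->
  sphere_div (fun u => g u *: tangent_proj u v) w =
  dot (sphere_grad g w) (tangent_proj w v) - (n%:R - 1) * (g w * dot w v).
Proof.
move=> Cg ws; rewrite /sphere_div.
have dE i : is_derive w (delta_mx 0 i) (fun x => (g (direction x) *: tangent_proj (direction x) v) 0 i)
   (sphere_grad g w 0 i * tangent_proj w v 0 i -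
    g w * (tangent_proj w v 0 i * w 0 i + dot w v * (1 - w 0 i ^+ 2))).
  rewrite (_ : (fun x => _) = fun x => (g \o @direction R n) x *
    tangent_proj (direction x) v 0 i); last first.
    by apply/funext => x; rewrite mxE.
  have d1 := is_derive_sphere_grad i Cg (sphere_neq0 ws).
  apply: (is_derive_eq (is_derive_mul d1 (is_derive_sphere_tangent_proj v i ws))).
  by rewrite /= direction_id//; ring.
rewrite (eq_bigr _ (fun i _ => derive_val (is_derive := dE i))) sumrB; congr (_ - _).
rewrite -mulr_sumr big_split/= -/(dot (tangent_proj w v) w) dotC dot_tangent_proj// add0r.
rewrite -mulr_sumr sumrB (_ : \sum_i w 0 i ^+ 2 = 1) ?sumr_const ?card_ord; first by ring.
by rewrite -(dot_sphere ws); apply: eq_bigr => i _; rewrite expr2.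
Qed.

End sphere_Ck_closure.

(** * Moments of w . Omega on the sphere *)

Section moments.
Context (R : realType) (n : nat) (Omega : 'rV[R]_n).
Hypothesis Os : sphere Omega.
Local Notation sigma := (@uniform_sphere R n).
Local Notation S := (@sphere R n).

Definition moment k : R := \int[sigma]_(w in S) dot w Omega ^+ k.
Definition coord_moment l k : R := \int[sigma]_(w in S) (w 0 l * dot w Omega ^+ k).

Let Cdot p k : sphere_Ck p (fun w => dot w Omega ^+ k).
Proof. by apply: sphere_CkX; exact: sphere_Ck_dot. Qed.

Let Ccoord p l k : sphere_Ck p (fun w => w 0 l * dot w Omega ^+ k).
Proof. by apply: sphere_CkM; [exact: sphere_Ck_coord|exact: Cdot]. Qed.

Lemma Rdivergence_theorem (A : 'rV[R]_n -> 'rV[R]_n) :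
  (forall i, sphere_Ck 1 (fun x => A x 0 i)) ->
  (forall w, sphere w -> dot w (A w) = 0) ->
  \int[sigma]_(w in S) sphere_div A w = 0.
Proof. by move=> CA tA; rewrite /Rintegral divergence_theorem. Qed.

Lemma coord_moment_rec l k :
  (n%:R - 1 + k%:R) * coord_moment l k = k%:R * Omega 0 l * moment k.-1.
Proof.
have mS := @measurable_sphere R n.
pose v : 'rV[R]_n := delta_mx 0 l.
pose A (u : 'rV[R]_n) := dot u Omega ^+ k *: tangent_proj u v.
have CA i : sphere_Ck 1 (fun x => A x 0 i).
  apply: sphere_Ck_congr (sphere_CkM (Cdot 1 k) (sphere_Ck_tangent_proj 1 v i)).
  by move=> w _; rewrite [RHS]mxE.
have tA w : sphere w -> dot w (A w) = 0 by move=> ws; rewrite dotZr dot_tangent_proj// mulr0.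
have := Rdivergence_theorem CA tA.
have divE w : sphere w -> sphere_div A w =
    k%:R * Omega 0 l * dot w Omega ^+ k.-1 - (n%:R - 1 + k%:R) * (w 0 l * dot w Omega ^+ k).
  move=> ws; rewrite sphere_div_tangent_proj//.
  have gE : sphere_grad (fun u => dot u Omega ^+ k) w = (k%:R * dot w Omega ^+ k.-1) *: tangent_proj w Omega.
    apply/rowP => i; rewrite [LHS]mxE [RHS]mxE.
    have := @is_deriveX _ _ (fun x => dot (direction x) Omega) k _ _ _ (is_derive_sphere_dot Omega i ws).
    rewrite (_ : _ ^+ k = (fun u : 'rV[R]_n => dot u Omega ^+ k) \o @direction R n); last first.
      by apply/funext => x; rewrite exprfctE.
    by move=> dk; rewrite (derive_val (is_derive := dk)) direction_id.
  have PP : dot (tangent_proj w Omega) (tangent_proj w v) = Omega 0 l - dot w Omega * w 0 l.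
    rewrite [X in dot _ X]/tangent_proj -scaleNr dotDr dotZr (dotC _ w) dot_tangent_proj// mulr0 addr0.
    by rewrite dotC dot_delta tangent_projE.
  (* For k = 0 the powers [k.-1] and k do not combine, but the gradient term has coefficient 0. *)
  rewrite gE dotZl PP (dotC w v) dot_delta; case: (k) => [|m]; first by rewrite !mul0r; ring.
  by rewrite exprS /=; ring.
have iC c p : sigma.-integrable S (EFin \o (fun w => c * dot w Omega ^+ p)).
  by apply: sphere_integrable; apply: sphere_CkM; [exact: sphere_Ck_cst|exact: Cdot].
have iCc c p : sigma.-integrable S (EFin \o (fun w : 'rV[R]_n => c * (w 0 l * dot w Omega ^+ p))).
  by apply: sphere_integrable; apply: sphere_CkM; [exact: sphere_Ck_cst|exact: Ccoord].
rewrite (@eq_Rintegral _ _ _ sigma S (fun w : 'rV[R]_n => k%:R * Omega 0 l * dot w Omega ^+ k.-1 -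
    (n%:R - 1 + k%:R) * (w 0 l * dot w Omega ^+ k))); last first.
  by move=> w; rewrite inE; exact: divE.
rewrite RintegralB// RintegralZl//; last by apply: sphere_integrable; exact: Cdot.
rewrite RintegralZl//; last by apply: sphere_integrable; exact: Ccoord.
by rewrite -/(moment _) -/(coord_moment _ _) => /eqP; rewrite subr_eq0 => /eqP ->.
Qed.

Lemma moment_coord_moment k : moment k.+1 = \sum_l Omega 0 l * coord_moment l k.
Proof.
have mS := @measurable_sphere R n.
have iC l : sigma.-integrable S (EFin \o (fun w : 'rV[R]_n => Omega 0 l * (w 0 l * dot w Omega ^+ k))).
  by apply: sphere_integrable; apply: sphere_CkM; [exact: sphere_Ck_cst|exact: Ccoord].
transitivity (\int[sigma]_(w in S) \sum_l (Omega 0 l * (w 0 l * dot w Omega ^+ k))).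
  apply: eq_Rintegral => w _; rewrite exprS mulr_suml; apply: eq_bigr => l _.
  by ring.
rewrite (Rintegral_sum mS _ iC).2; apply: eq_bigr => l _.
by rewrite RintegralZl//; apply: sphere_integrable; exact: Ccoord.
Qed.

(** The coordinate recursion contracted with the unit vector Omega. *)
Lemma moment_rec k : (n%:R - 1 + k%:R) * moment k.+1 = k%:R * moment k.-1.
Proof.
rewrite moment_coord_moment mulr_sumr.
under eq_bigr do rewrite mulrCA coord_moment_rec mulrA.
rewrite -mulr_suml; congr (_ * _); rewrite -[RHS]mulr1 -(dot_sphere Os) mulr_sumr.
by apply: eq_bigr => l _; ring.
Qed.

Lemma sphere_integral_gt0_continuous (g : 'rV[R]_n -> R) w0 : sphere_Ck 0 g ->
  (forall w, sphere w -> 0 <= g w) -> sphere w0 -> 0 < g w0 ->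
  0 < \int[sigma]_(w in S) g w.
Proof.
move=> cg g0 w0s gw0; rewrite fine_gt0//; apply/andP; split; last first.
  have := integrable_fin_num (@measurable_sphere R n) (sphere_integrable cg).
  by rewrite fin_numE ltey => /andP[].
apply: (@integral_sphere_gt0 R n g w0 (g w0 / 2)) => //; first by rewrite divr_gt0.
have := cg w0 (sphere_neq0 w0s).
move=> /(@cvgrPdist_lt _ _ _ (nbhs w0))/(_ (g w0 / 2)); rewrite divr_gt0// => /(_ isT).
apply: filterS => w /= + ws; rewrite !direction_id// ltr_norml; lra.
Qed.

End moments.

Section von_mises_flux.
Context (R : realType) (n : nat) (n2 : (2 <= n)%N) (Omega : 'rV[R]_n).
Hypothesis Os : sphere Omega.
Local Notation sigma := (@uniform_sphere R n).
Local Notation S := (@sphere R n).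
Local Notation a := (cos_moment R (n - 2)).
Local Notation m := (moment Omega).

Lemma sphere_Ck_exp_dot k kappa (v : 'rV[R]_n) : sphere_Ck k (fun w => expR (kappa * dot w v)).
Proof.
by apply: sphere_Ck_expR; apply: sphere_CkM; [exact: sphere_Ck_cst|exact: sphere_Ck_dot].
Qed.

Lemma von_mises_mass_gt0 kappa : 0 < \int[sigma]_(w in S) expR (kappa * dot w Omega).
Proof.
apply: (sphere_integral_gt0_continuous (sphere_Ck_exp_dot 0 kappa Omega) _ Os).
  by move=> w _; exact: expR_ge0.
exact: expR_gt0.
Qed.

(** Matches the recursion on the sphere with that of the cosine for N = n - 2, a genuine difference
    since n >= 2. *)
Let nE k : n%:R - 1 + k%:R = ((n - 2).+1 + k)%:R :> R.
Proof. by rewrite natrD -subSn// subn2 -pred_Sn -(subnK (ltnW n2)) /= addn1 /= mulrSr addrK. Qed.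

Let a0 : 0 < a 0. Proof. exact: cos_moment0_gt0. Qed.

Let nk_neq0 k : ((n - 2).+1 + k)%:R != 0 :> R.
Proof. by rewrite pnatr_eq0. Qed.

(** Both sequences obey one recursion of step two, whose case k = 0 makes the first moments vanish;
    hence the induction on consecutive pairs. *)
Lemma moment_cos_moment k : m k * a 0 = a k * m 0.
Proof.
suff : m k * a 0 = a k * m 0 /\ m k.+1 * a 0 = a k.+1 * m 0 by case.
elim: k => [|k [H1 H2]]; split=> //; first by rewrite mulrC.
  apply: (mulfI (nk_neq0 0)); rewrite !mulrA cos_moment_rec -nE.
  by rewrite (moment_rec Os 0) !mul0r.
apply: (mulfI (nk_neq0 k.+1)); rewrite !mulrA cos_moment_rec -nE.
by rewrite (moment_rec Os k.+1) /= -!mulrA H1.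
Qed.

Lemma coord_moment_cos_moment l k : coord_moment Omega l k * a 0 = a k.+1 * (Omega 0 l * m 0).
Proof.
apply: (mulfI (nk_neq0 k)); rewrite !mulrA cos_moment_rec -nE coord_moment_rec.
by rewrite -[LHS]mulrA moment_cos_moment; ring.
Qed.

Let mS := @measurable_sphere R n.
Let mI : measurable (`[0, pi]%classic : set (measurableTypeR R)).
Proof. exact: measurable_itv. Qed.

Let Soo : (sigma S < +oo)%E.
Proof. by rewrite (le_lt_trans (probability_le1 _ mS))// ltry. Qed.

Let msin k : measurable_fun (`[0, pi]%classic : set (measurableTypeR R)) (fun t : R => sin t ^+ k).
Proof.
apply: measurable_funX; apply: measurable_funTS; apply: continuous_measurable_fun.
exact: continuous_sin.
Qed.

Let mcos : measurable_fun (`[0, pi]%classic : set (measurableTypeR R)) (@cos R).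
Proof. by apply: measurable_funTS; apply: continuous_measurable_fun; exact: continuous_cos. Qed.

Let cos1 (t : R) : `|cos t| <= 1. Proof. by rewrite ler_norml cos_geN1 cos_le1. Qed.
Let sinX1 k (t : R) : `|sin t ^+ k| <= 1.
Proof. by rewrite normrX exprn_ile1// ler_norml sin_geN1 sin_le1. Qed.

Let dot1 w : S w -> `|dot w Omega| <= 1.
Proof. by move=> ws; exact: dot_sphere_le1. Qed.

(** Flux and mass on the sphere are the numerator and the denominator of [order_c], both multiplied
    by m 0 / a 0; this factor drops out of their quotient. *)
Lemma J_expR kappa : J (fun w => expR (kappa * dot w Omega)) =
  (order_c n kappa * \int[sigma]_(w in S) expR (kappa * dot w Omega)) *: Omega.
Proof.
set Z := \int[sigma]_(w in S) _.
pose num := \int[@lebesgue_measure R]_(t in `[0, pi]) (cos t * expR (kappa * cos t) * sin t ^+ (n - 2)).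
pose den := \int[@lebesgue_measure R]_(t in `[0, pi]) (expR (kappa * cos t) * sin t ^+ (n - 2)).
have Zden : Z * a 0 = den * m 0.
  have := @integral_exp_eq_moments _ _ _ _ R sigma (@lebesgue_measure R) S (`[0, pi]%classic)
    (fun w => dot w Omega) (fun=> 1) (@cos R) (fun t => sin t ^+ (n - 2)) (a 0) (m 0) kappa
    mS mI Soo (lebesgue_0pi_lty R) (sphere_Ck0_measurable (sphere_Ck_dot 0 Omega))
    (measurable_cst _) mcos (msin _) dot1 _ (fun t _ => cos1 t) (fun t _ => sinX1 _ t) _.
  move=> H; transitivity (\int[sigma]_(w in S) (1 * expR (kappa * dot w Omega)) * a 0).
    by congr (_ * _); apply: eq_Rintegral => w _; rewrite mul1r.
  rewrite H; first by congr (_ * _); apply: eq_Rintegral => t _; rewrite mulrC.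
    by move=> w _; rewrite normr1.
  move=> k; rewrite (_ : \int[sigma]_(w in S) _ = m k).
    rewrite moment_cos_moment; congr (_ * _); apply: eq_Rintegral => t _.
    by rewrite mulrC.
  by apply: eq_Rintegral => w _; rewrite mul1r.
have Jnum l : J (fun w => expR (kappa * dot w Omega)) 0 l * a 0 = num * (Omega 0 l * m 0).
  rewrite mxE.
  have := @integral_exp_eq_moments _ _ _ _ R sigma (@lebesgue_measure R) S (`[0, pi]%classic)
    (fun w => dot w Omega) (fun w => w 0 l) (@cos R)
    (fun t => cos t * sin t ^+ (n - 2)) (a 0) (Omega 0 l * m 0) kappa
    mS mI Soo (lebesgue_0pi_lty R) (sphere_Ck0_measurable (sphere_Ck_dot 0 Omega))
    (sphere_Ck0_measurable (sphere_Ck_coord R 0 l)) mcos (measurable_funM mcos (msin _)) dot1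
    (fun w ws => coord_sphere_le1 l ws) (fun t _ => cos1 t) _ _.
  move=> H; rewrite H.
  - congr (_ * _); apply: eq_Rintegral => t _; ring.
  - by move=> t _; rewrite normrM mulr_ile1.
  - move=> k; rewrite -/(coord_moment _ l k) coord_moment_cos_moment; congr (_ * _).
    by apply: eq_Rintegral => t _; rewrite exprS; ring.
have Z0 : 0 < Z by exact: von_mises_mass_gt0.
have den0 : den != 0.
  apply/eqP => d0; move: Zden; rewrite d0 mul0r => /eqP.
  by rewrite mulf_eq0 !gt_eqF.
apply/rowP => l; rewrite [RHS]mxE.
apply: (mulIf (lt0r_neq0 a0)); rewrite Jnum /order_c -/num -/den.
rewrite mulrAC -[X in _ = X * _]mulrA Zden; field; exact: den0.
Qed.

End von_mises_flux.

(** * Equilibria *)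

Section gauge.
Context (R : realType) (n : nat) (kappa : R) (v : 'rV[R]_n).
Implicit Types (f g : 'rV[R]_n -> R) (w : 'rV[R]_n) (A B : 'rV[R]_n -> 'rV[R]_n).
Local Notation e_ i := (delta_mx 0 i : 'rV[R]_n).
Local Notation sigma := (@uniform_sphere R n).
Local Notation S := (@sphere R n).

Lemma sphere_grad_congr f g w : sphere w -> (forall u, sphere u -> f u = g u) ->
  sphere_grad f w = sphere_grad g w.
Proof.
move=> ws fg; apply/rowP => i; rewrite !mxE; apply: near_eq_derive.
near=> x; apply: fg; apply: direction_sphere.
by near: x; apply: near_punctured; exact: sphere_neq0.
Unshelve. all: by end_near. Qed.

Lemma sphere_div_congr A B w : sphere w -> (forall u, sphere u -> A u = B u) ->
  sphere_div A w = sphere_div B w.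
Proof.
move=> ws AB; apply: eq_bigr => i _; apply: near_eq_derive.
near=> x; rewrite AB//; apply: direction_sphere.
by near: x; apply: near_punctured; exact: sphere_neq0.
Unshelve. all: by end_near. Qed.

(** The degree-0 extension of the gradient is |x| times the gradient of the extension, and |x| =
    |x|^2 |x|^-1 is smooth off 0. *)
Lemma sphere_grad_Ck k f i : sphere_Ck k.+1 f -> sphere_Ck k (fun u => sphere_grad f u 0 i).
Proof.
move=> Cf; have oP := @open_punctured R n.
have Ce : partials_Ck k (@punctured R n) (fun x => (\sum_j x 0 j * x 0 j) * (enorm x)^-1).
  apply: partials_CkM => //; last exact: partials_Ck_inv_enorm.
  by apply: partials_Ck_sum => // j; apply: partials_CkM => //; exact: partials_Ck_coord.
apply: partials_Ck_congr (partials_CkM oP Ce (Cf i).2) => // x x0 /=.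
have xd : direction x != 0 by apply/sphere_neq0/direction_sphere.
rewrite mxE derive_homogeneous//; last exact: (Cf i).1.
rewrite -/(dot x x) -sqr_enorm expr2 mulfK ?enorm_eq0//.
by rewrite mulrA mulfV ?mul1r// enorm_eq0.
Qed.

Lemma dot_sphere_grad f w : sphere_Ck 1 f -> sphere w -> dot w (sphere_grad f w) = 0.
Proof.
move=> Cf ws; rewrite -(radial_derivative Cf (sphere_neq0 ws)).
by apply: eq_bigr => i _; rewrite mxE.
Qed.

Lemma is_derive_field A w i : (forall i, sphere_Ck 1 (fun x => A x 0 i)) -> sphere w ->
  is_derive w (e_ i) (fun x => A (direction x) 0 i) ('D_(e_ i) (fun x => A (direction x) 0 i) w).
Proof. by move=> CA ws; apply: derivableP; apply: (CA i i).1; exact: sphere_neq0. Qed.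

Lemma sphere_divB A B (c : R) w : (forall i, sphere_Ck 1 (fun x => A x 0 i)) ->
  (forall i, sphere_Ck 1 (fun x => B x 0 i)) -> sphere w ->
  sphere_div (fun u => A u - c *: B u) w = sphere_div A w - c * sphere_div B w.
Proof.
move=> CA CB ws; rewrite mulr_sumr -sumrB; apply: eq_bigr => i _.
have d := is_derive_add (is_derive_field i CA ws) (is_derive_mulr (- c) (is_derive_field i CB ws)).
rewrite (_ : (fun x => _) = fun y => A (direction y) 0 i + B (direction y) 0 i * - c).
  by rewrite (derive_val (is_derive := d)); ring.
by apply/funext => x; rewrite !mxE mulrN mulrC.
Qed.

Lemma sphere_divM g A w : sphere_Ck 1 g -> (forall i, sphere_Ck 1 (fun x => A x 0 i)) ->
  sphere w ->
  sphere_div (fun u => g u *: A u) w = dot (sphere_grad g w) (A w) + g w * sphere_div A w.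
Proof.
move=> Cg CA ws; rewrite mulr_sumr -big_split; apply: eq_bigr => i _.
have d := is_derive_mul (is_derive_sphere_grad i Cg (sphere_neq0 ws)) (is_derive_field i CA ws).
rewrite (_ : (fun x => _) = fun y => (g \o @direction R n) y * A (direction y) 0 i).
  by rewrite (derive_val (is_derive := d)) /= direction_id.
by apply/funext => x; rewrite mxE.
Qed.

(** By homogeneity the extension has zero partial derivatives on all of the punctured space, which
    is connected for n >= 2. For n = 1 the sphere is two points and the conclusion fails. *)
Lemma sphere_constant f : (2 <= n)%N -> sphere_Ck 1 f ->
  (forall w, sphere w -> sphere_grad f w = 0) ->
  forall u w, sphere u -> sphere w -> f u = f w.
Proof.
move=> n2 Cf df u w us ws.
rewrite -[u]direction_id// -[w]direction_id//.
apply: (@zero_partials_constant R n (f \o @direction R n)) => //; try exact: sphere_neq0.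
move=> x i x0; have ds := direction_sphere x0.
apply: (is_derive_eq (derivableP (derivable_sphere_Ck1 (i := i) Cf x0))).
rewrite derive_homogeneous//; last exact/(derivable_sphere_Ck1 Cf)/sphere_neq0.
by have /rowP/(_ i) := df _ ds; rewrite !mxE => ->; rewrite mulr0.
Qed.

(** f e^-t, and below it the field A, for free [kappa] and [v]; [v] may be 0, as happens when J f =
    0. *)
Definition gauge f w := f w * expR (- (kappa * dot w v)).
Definition flux f w := sphere_grad f w - (kappa * f w) *: tangent_proj w v.

Lemma gauge_Ck k f : sphere_Ck k f -> sphere_Ck k (gauge f).
Proof.
move=> Cf; apply: sphere_CkM => //; apply: sphere_Ck_congr (sphere_Ck_exp_dot k (- kappa) v).
by move=> w _; rewrite mulNr.
Qed.

Lemma gauge_grad f w : sphere_Ck 1 f -> sphere w ->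
  sphere_grad (gauge f) w = expR (- (kappa * dot w v)) *: flux f w.
Proof.
move=> Cf ws; apply/rowP => i; rewrite [LHS]mxE.
have d1 := is_derive_mulr (- kappa) (is_derive_sphere_dot v i ws).
have d2 := is_derive_comp d1 (is_derive_expR _).
have d3 := is_derive_mul (is_derive_sphere_grad i Cf (sphere_neq0 ws)) d2.
rewrite (_ : gauge f \o _ = fun y => (f \o @direction R n) y * expR (dot (direction y) v * - kappa)).
  rewrite (derive_val (is_derive := d3)) /= direction_id//.
  rewrite [RHS]mxE [X in _ = _ * X]mxE [X in _ = _ * (_ + X)]mxE [X in _ = _ * (_ - X)]mxE.
  by rewrite (_ : dot w v * - kappa = - (kappa * dot w v)); ring.
by apply/funext => x; rewrite /gauge /= mulrN [dot _ _ * _]mulrC.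
Qed.

Lemma dot_flux f w : sphere_Ck 1 f -> sphere w -> dot w (flux f w) = 0.
Proof.
move=> Cf ws; rewrite /flux -scaleNr dotDr dotZr dot_sphere_grad// dot_tangent_proj//.
by rewrite mulr0 addr0.
Qed.

Lemma tangent_field_Ck f k i : sphere_Ck k f -> sphere_Ck k (fun u => (f u *: tangent_proj u v) 0 i).
Proof.
move=> Cf; apply: sphere_Ck_congr (sphere_CkM Cf (sphere_Ck_tangent_proj k v i)).
by move=> w _; rewrite [RHS]mxE.
Qed.

Lemma flux_Ck f k i : sphere_Ck k.+1 f -> sphere_Ck k (fun u => flux f u 0 i).
Proof.
move=> Cf; have Cg := sphere_CkM (@sphere_Ck_cst R n k kappa) (tangent_field_Ck i (sphere_CkW Cf)).
apply: sphere_Ck_congr (sphere_CkB (sphere_grad_Ck i Cf) Cg) => w _.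
by rewrite /flux [RHS]mxE [X in _ = _ + X]mxE [X in _ = _ - X]mxE [X in _ - _ * X = _]mxE mulrA.
Qed.

Lemma sphere_div_flux f w : sphere_Ck 2 f -> sphere w -> sphere_div (flux f) w =
  sphere_laplacian f w - kappa * sphere_div (fun u => f u *: tangent_proj u v) w.
Proof.
move=> Cf ws; rewrite -(@sphere_divB (sphere_grad f))//.
- by apply: sphere_div_congr => // u _; rewrite /flux scalerA.
- by move=> i; exact: sphere_grad_Ck.
- by move=> i; apply: tangent_field_Ck; exact: sphere_CkW.
Qed.

Lemma flux_eq0 f w : sphere_Ck 1 f -> sphere w -> (flux f w == 0) = (sphere_grad (gauge f) w == 0).
Proof. by move=> Cf ws; rewrite gauge_grad// scaler_eq0 gt_eqF ?expR_gt0. Qed.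

Lemma div_flux0_grad0 f : sphere_Ck 2 f -> (forall w, sphere w -> sphere_div (flux f) w = 0) ->
  forall w, sphere w -> flux f w = 0.
Proof.
move=> C2 div0 w0 w0s; have C1 := sphere_CkW C2; have Ch := gauge_Ck C1.
have CA i : sphere_Ck 1 (fun u => flux f u 0 i) by exact: flux_Ck.
(* The gradient of [gauge f] is e^-t A, so div B = e^-t |A|^2 once div A = 0. The C^2 regularity of
   f is what makes A, hence B, a C^1 field. *)
pose B u := gauge f u *: flux f u.
have CB i : sphere_Ck 1 (fun u => B u 0 i).
  by apply: sphere_Ck_congr (sphere_CkM Ch (CA i)) => w _; rewrite [RHS]mxE.
have divB w : sphere w -> sphere_div B w = expR (- (kappa * dot w v)) * dot (flux f w) (flux f w).
  move=> ws; rewrite sphere_divM// div0// mulr0 addr0 gauge_grad// dotZl.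
  by [].
have tB w : sphere w -> dot w (B w) = 0 by move=> ws; rewrite dotZr dot_flux// mulr0.
apply/eqP; apply: contraT => A0.
have := @sphere_integral_gt0_continuous R n (sphere_div B) w0 (sphere_div_Ck0 CB) _ w0s _.
rewrite Rdivergence_theorem// ltxx; apply.
  by move=> w ws; rewrite divB// mulr_ge0 ?expR_ge0 ?dotxx_ge0.
by rewrite divB// mulr_gt0 ?expR_gt0// lt_neqAle eq_sym dotxx_eq0 A0 dotxx_ge0.
Qed.

Lemma sphere_grad_at_zero f w : sphere_Ck 1 f -> (forall u, sphere u -> 0 <= f u) ->
  sphere w -> f w = 0 -> sphere_grad f w = 0.
Proof.
move=> Cf f0 ws fw; apply/rowP => i; rewrite [RHS]mxE.
(* w and e_i are unit vectors, so the line through w can meet the origin only at |t| = 1; on the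
   open interval the extension is differentiable and minimal at 0. *)
have nz (t : R) : t \in `]-1, 1[ -> t *: e_ i + w != 0.
  rewrite in_itv/= -ltr_norml => t1; apply/eqP => /eqP; rewrite addrC addr_eq0 => /eqP wE.
  move: ws; rewrite wE /sphere /= -scaleNr enormZ normrN /enorm dot_delta mxE !eqxx sqrtr1 mulr1.
  by move=> tE; move: t1; rewrite tE ltxx.
have [_ <-] : is_derive (0 : R) 1 (fun t : R => (f \o @direction R n) (t *: e_ i + w)) 0.
  apply: (@derive1_at_min _ _ (-1) 1); rewrite ?in_itv/=; try lra.
  - move=> t /nz t0.
    by have [] := is_derive_line (derivableP (derivable_sphere_Ck1 Cf t0)).
  - move=> t /nz t0; rewrite scale0r add0r direction_id// fw.
    by apply: f0; exact: direction_sphere.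
have := is_derive_sphere_grad i Cf (sphere_neq0 ws).
rewrite -{1}[w]add0r -{1}(scale0r (e_ i)) => d.
by rewrite (derive_val (is_derive := is_derive_line d)).
Qed.

Lemma log_gauge_grad f w : sphere_Ck 1 f -> sphere w -> 0 < f w ->
  sphere_grad (fun u => ln (f u) - kappa * dot u v) w = (f w)^-1 *: flux f w.
Proof.
move=> Cf ws fw; apply/rowP => i; rewrite [LHS]mxE.
have d1 := is_derive_mulr (- kappa) (is_derive_sphere_dot v i ws).
have fw' : 0 < (f \o @direction R n) w by rewrite /= direction_id.
have d2 := is_derive_comp (is_derive_sphere_grad i Cf (sphere_neq0 ws)) (is_derive1_ln fw').
have d3 := is_derive_add d2 d1.
rewrite (_ : _ \o _ = fun y => ln ((f \o @direction R n) y) + dot (direction y) v * - kappa).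
  rewrite (derive_val (is_derive := d3)) /= direction_id//.
  rewrite [RHS]mxE [X in _ = _ * X]mxE [X in _ = _ * (_ + X)]mxE [X in _ = _ * (_ - X)]mxE.
  field; exact: lt0r_neq0.
by apply/funext => x; rewrite /= mulrN [dot _ _ * _]mulrC.
Qed.

(** Where f > 0 the gradient of the logarithm is A / f; where f = 0 both sides are 0, the right one
    because 0^-1 = 0. *)
Lemma dissipation_density f w : sphere_Ck 1 f -> (forall u, sphere u -> 0 <= f u) -> sphere w ->
  f w * enorm (sphere_grad (fun u => ln (f u) - kappa * dot u v) w) ^+ 2 =
  (f w)^-1 * dot (flux f w) (flux f w).
Proof.
move=> Cf f0 ws; have [fw|fw] := eqVneq (f w) 0; first by rewrite fw invr0 !mul0r.
have {}fw : 0 < f w by rewrite lt_neqAle eq_sym fw f0.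
rewrite log_gauge_grad// sqr_enorm dotZl dotZr; field; exact: lt0r_neq0.
Qed.

Lemma dissipation0_flux0 f : sphere_Ck 1 f -> (forall u, sphere u -> 0 <= f u) ->
  (\int[sigma]_(w in S) (f w * enorm (sphere_grad (fun u => ln (f u) - kappa * dot u v) w) ^+ 2)%:E = 0)%E ->
  forall w, sphere w -> flux f w = 0.
Proof.
move=> Cf f0 D0 w ws; have [fw|fw] := eqVneq (f w) 0.
  by rewrite /flux fw mulr0 scale0r subr0; exact: sphere_grad_at_zero.
have {}fw : 0 < f w by rewrite lt_neqAle eq_sym fw f0.
apply/eqP; apply: contraT => A0.
(* The form |A|^2 / f of the density is continuous near w because f w > 0, so it stays above half
   its value there. *)
pose g u := (f u)^-1 * \sum_i flux f u 0 i * flux f u 0 i.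
have gw : 0 < g w.
  by rewrite mulr_gt0 ?invr_gt0// lt_neqAle eq_sym dotxx_eq0 A0 dotxx_ge0.
suff : (0 < \int[sigma]_(w in S)
    (f w * enorm (sphere_grad (fun u => ln (f u) - kappa * dot u v) w) ^+ 2)%:E)%E.
  by rewrite D0 ltxx.
apply: (@integral_sphere_gt0 R n _ w (g w / 2)) => //.
- by move=> u us; rewrite mulr_ge0 ?f0// exprn_ge0// enorm_ge0.
- by rewrite divr_gt0.
have w0 := sphere_neq0 ws; have oP := @open_punctured R n.
have C0 : {for w, continuous (fun u => \sum_i flux f (direction u) 0 i * flux f (direction u) 0 i)}.
  apply: (partials_Ck_sum (k := 0) oP) => // i.
  by apply: (partials_CkM (k := 0) oP); exact: (flux_Ck (k := 0)).
have Cg : {for w, continuous (g \o @direction R n)}.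
  apply: continuousM; last exact: C0.
  apply: (@continuous_comp _ _ _ (f \o @direction R n) (fun r : R => r^-1)).
    exact: (sphere_CkW Cf).
  by apply: inv_continuous; rewrite /= direction_id// gt_eqF.
have g2 : 0 < g w / 2 by rewrite divr_gt0.
move: Cg => /(@cvgrPdist_lt _ _ _ (nbhs w))/(_ _ g2); apply: filterS => u + us.
rewrite /= !direction_id// dissipation_density// -/(g u) ltr_norml; lra.
Qed.

End gauge.

(** * The rate k and its inverse *)

Section rates.
Context (R : realType) (nu tau j : R -> R) (kmax : \bar R).
Hypothesis nu_ge0 : forall r, 0 <= r -> 0 <= nu r.
Hypothesis tau_gt0 : forall r, 0 <= r -> 0 < tau r.
Hypothesis k_incr : forall r s, 0 <= r -> r < s -> krate nu tau r < krate nu tau s.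
Hypothesis k_lim : (krate nu tau r)%:E @[r --> +oo] --> kmax.
Hypothesis kj : forall kappa, 0 <= kappa -> (kappa%:E < kmax)%E ->
  0 <= j kappa /\ krate nu tau (j kappa) = kappa.

Lemma krate_ge0 r : 0 <= r -> 0 <= krate nu tau r.
Proof. by move=> r0; rewrite divr_ge0 ?nu_ge0// ltW// tau_gt0. Qed.

(** Strict increase keeps the limit from being attained: k(r) < k(r + 1) <= kmax. *)
Lemma krate_lt_kmax r : 0 <= r -> ((krate nu tau r)%:E < kmax)%E.
Proof.
move=> r0; apply: (@lt_le_trans _ _ (krate nu tau (r + 1))%:E).
  by rewrite lte_fin k_incr// ltrDl.
move/cvg_lim : (k_lim) => <- //; apply: lime_ge; first by apply/cvg_ex; exists kmax.
near=> s; rewrite lee_fin ltW// k_incr//; first by rewrite addr_ge0.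
by near: s; apply: nbhs_pinfty_gt; exact: num_real.
Unshelve. all: by end_near. Qed.

(** 0 <= k(0) < kmax puts 0 in the domain of j, so k(j(0)) = 0; a positive j(0) would give k(0) <
    0. *)
Lemma krate0 : krate nu tau 0 = 0.
Proof.
have k0 := krate_ge0 (lexx 0).
have [|j0 kj0] := kj (lexx 0).
  by apply: le_lt_trans (krate_lt_kmax (lexx 0)); rewrite lee_fin.
have [j0'|j0'] := ltP 0 (j 0).
  by have := k_incr (lexx 0) j0'; rewrite kj0; lra.
have jE : j 0 = 0 by apply: le_anti; rewrite j0 j0'.
by rewrite jE in kj0.
Qed.

End rates.

(** * Vanishing of the collision operator, of the dissipation and of the flux field *)

Section equilibria.
Context (R : realType) (n : nat) (n2 : (2 <= n)%N) (nu tau : R -> R).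
Context (f : 'rV[R]_n -> R).
Hypothesis tau_gt0 : forall r, 0 <= r -> 0 < tau r.
Hypothesis f_ge0 : forall w, sphere w -> 0 <= f w.
Local Notation sigma := (@uniform_sphere R n).
Local Notation S := (@sphere R n).
Local Notation r := (enorm (J f)).
Local Notation kappa := (krate nu tau r).
Local Notation A := (flux kappa (direction (J f)) f).

Lemma Q_flux w : sphere_Ck 2 f -> sphere w -> Q nu tau f w = tau r * sphere_div A w.
Proof.
move=> Cf ws; rewrite /Q sphere_div_flux// mulrBr mulrA.
have -> : tau r * kappa = nu r.
  by rewrite /krate mulrCA mulfV ?mulr1// gt_eqF// tau_gt0// enorm_ge0.
by rewrite mulNr addrC.
Qed.

Lemma Q0_flux0 : sphere_Ck 2 f -> (forall w, sphere w -> Q nu tau f w = 0) <->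
  (forall w, sphere w -> A w = 0).
Proof.
move=> Cf; split=> [Q0|A0 w ws].
  apply: div_flux0_grad0 => // w ws; apply/eqP.
  by move: (Q0 w ws); rewrite Q_flux// => /eqP; rewrite mulf_eq0 gt_eqF// tau_gt0// enorm_ge0.
rewrite Q_flux// (@sphere_div_congr _ _ _ (fun=> 0))//.
rewrite /sphere_div big1 ?mulr0// => i _.
rewrite (_ : (fun _ => _) = cst 0); first exact: derive_cst.
by apply/funext => x; rewrite mxE.
Qed.

Lemma dissipation0 : sphere_Ck 1 f -> dissipation nu tau f = 0%E <->
  (forall w, sphere w -> A w = 0).
Proof.
move=> Cf; rewrite /dissipation; split=> [D0|A0].
  apply: dissipation0_flux0 => //; apply/eqP; move/eqP: D0.
  by rewrite mule_eq0 eqe gt_eqF// tau_gt0// enorm_ge0.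
rewrite integral0_eq ?mule0// => w ws.
by rewrite dissipation_density// A0// dot0r mulr0.
Qed.

Lemma J_scale (g : 'rV[R]_n -> R) (c : R) : sphere_Ck 0 g ->
  (forall w, sphere w -> f w = c * g w) -> J f = c *: J g.
Proof.
move=> Cg fE; apply/rowP => i; rewrite !mxE -RintegralZl//.
- by apply: eq_Rintegral => w; rewrite inE => /fE ->; rewrite mulrCA.
- exact: measurable_sphere.
- by apply: sphere_integrable; apply: sphere_CkM => //; exact: sphere_Ck_coord.
Qed.

Lemma J_von_mises rho Omega k : sphere Omega ->
  (forall w, sphere w -> f w = rho * von_mises k Omega w) ->
  J f = (rho * order_c n k) *: Omega.
Proof.
move=> Os fE; have Z0 := von_mises_mass_gt0 Os k.
pose Z := \int[sigma]_(w in S) expR (k * dot w Omega).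
rewrite (@J_scale (fun w => expR (k * dot w Omega)) (rho / Z)).
- rewrite (J_expR n2 Os) scalerA; congr (_ *: _); rewrite -/Z; field; exact: lt0r_neq0.
- exact: sphere_Ck_exp_dot.
- by move=> w /fE ->; rewrite /von_mises -/Z mulrA mulrAC.
Qed.

End equilibria.
Theorem proposition2p2 (R : realType) (n : nat) (hn : (2 <= n)%N)
    (nu tau j : R -> R) (kmax : \bar R)
    (nu_ge0 : forall r, 0 <= r -> 0 <= nu r)
    (tau_gt0 : forall r, 0 <= r -> 0 < tau r)
    (nu_lip : [lipschitz nu r / r | r in [set r : R | 0 < r]])
    (nu_bnd : [bounded nu r / r | r in [set r : R | 0 < r]])
    (tau_lip : [lipschitz tau r | r in [set r : R | 0 <= r]])
    (tau_bnd : [bounded tau r | r in [set r : R | 0 <= r]])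
    (k_incr : forall r s, 0 <= r -> r < s -> krate nu tau r < krate nu tau s)
    (k_lim : (krate nu tau r)%:E @[r --> +oo] --> kmax)
    (jk : forall r, 0 <= r -> j (krate nu tau r) = r)
    (kj : forall kappa, 0 <= kappa -> (kappa%:E < kmax)%E ->
       0 <= j kappa /\ krate nu tau (j kappa) = kappa)
    (f : 'rV[R]_n -> R) (f_ge0 : forall w, sphere w -> 0 <= f w) :
  let stmt_i := sphere_Ck 2 f /\ forall w, sphere w -> Q nu tau f w = 0 in
  let stmt_ii := sphere_Ck 1 f /\ dissipation nu tau f = 0%E in
  let stmt_iii := exists (rho : R) (Omega : 'rV[R]_n) (kappa : R),
    [/\ 0 <= rho, sphere Omega, 0 <= kappa /\ (kappa%:E < kmax)%E,
        j kappa = rho * order_c n kappa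
      & forall w, sphere w -> f w = rho * von_mises kappa Omega w] in
  (stmt_i <-> stmt_ii) /\ (stmt_ii <-> stmt_iii).
Proof.
set r := enorm (J f); set kappa0 := krate nu tau r; set v := direction (J f).
have r0 : 0 <= r by exact: enorm_ge0.
have k0 := krate0 nu_ge0 tau_gt0 k_incr k_lim kj.
(* Replaces [v], which is 0 when J f = 0, by a unit vector; in that case kappa0 = k(0) = 0 and any
   one will do. *)
have kappa_dir : exists2 Omega, sphere Omega & J f = r *: Omega /\ kappa0 *: Omega = kappa0 *: v.
  have [J0|J0] := eqVneq (J f) 0.
    have i0 : 'I_n by case: (n) hn => // m _; exact: ord0.
    exists (delta_mx 0 i0); first by rewrite /sphere /= /enorm dot_delta mxE !eqxx sqrtr1.
    by rewrite /kappa0 /r J0 enorm0 k0 !scale0r.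
  by exists v; [exact: direction_sphere|rewrite enorm_direction].
have flux_iii : sphere_Ck 1 f -> (forall w, sphere w -> flux kappa0 v f w = 0) ->
  exists (rho : R) (Omega : 'rV[R]_n) (kappa : R),
    [/\ 0 <= rho, sphere Omega, 0 <= kappa /\ (kappa%:E < kmax)%E,
        j kappa = rho * order_c n kappa
      & forall w, sphere w -> f w = rho * von_mises kappa Omega w].
  move=> Cf A0; have [om Os [JE kE]] := kappa_dir.
  (* The value of the constant f e^-t; rho is C times the mass Z of the exponential. *)
  pose C := gauge kappa0 v f om.
  pose Z := \int[@uniform_sphere R n]_(w in @sphere R n) expR (kappa0 * dot w om).
  have Z0 : 0 < Z := von_mises_mass_gt0 Os kappa0.
  have fE w : sphere w -> f w = C * Z * von_mises kappa0 om w.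
    move=> ws; rewrite /von_mises -/Z -mulrA (mulrC Z) divfK ?gt_eqF//.
    rewrite /C (@sphere_constant _ _ _ hn _ _ _ w)//.
    - by rewrite /gauge -!dotZr kE -mulrA -expRD addNr expR0 mulr1.
    - exact: gauge_Ck.
    - by move=> u us; apply/eqP; rewrite -flux_eq0// A0.
  have C0 : 0 <= C by rewrite mulr_ge0 ?f_ge0 ?expR_ge0.
  (* The flux of f computed in two ways, along om. Since j(kappa0) = j(k(r)) = r, this is the
     compatibility equation. *)
  have rE : r = C * Z * order_c n kappa0.
    have := J_von_mises hn Os fE; rewrite JE => /(congr1 (dot om)).
    by rewrite !dotZr dot_sphere// !mulr1.
  exists (C * Z), om, kappa0; split=> //.
  - by rewrite mulr_ge0// ltW.
  - by split; [exact: (krate_ge0 nu_ge0 tau_gt0)|exact: (krate_lt_kmax k_incr k_lim)].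
  - by rewrite jk.
have iii_flux : (exists (rho : R) (Omega : 'rV[R]_n) (kappa : R),
    [/\ 0 <= rho, sphere Omega, 0 <= kappa /\ (kappa%:E < kmax)%E,
        j kappa = rho * order_c n kappa
      & forall w, sphere w -> f w = rho * von_mises kappa Omega w]) ->
  sphere_Ck 2 f /\ (forall w, sphere w -> flux kappa0 v f w = 0).
  move=> [rho [om [kappa [rho0 Os [kap0 kapmax] jE fE]]]].
  have [j0 kjE] := kj _ kap0 kapmax.
  (* Compatibility says that f produces |J f| = j(kappa), hence the rate k(|J f|) is the given
     kappa. *)
  have JE : J f = j kappa *: om by rewrite jE (J_von_mises hn Os fE).
  have rE : r = j kappa by rewrite /r JE enormZ Os mulr1 ger0_norm.
  have kE : kappa0 = kappa by rewrite /kappa0 rE.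
  (* The directions agree unless j(kappa) = 0, and then kappa = k(0) = 0. *)
  have vE : kappa *: v = kappa *: om.
    have [jk0|jk0] := eqVneq (j kappa) 0; first by rewrite -kjE jk0 k0 !scale0r.
    by rewrite /v JE directionZ ?direction_id// lt_neqAle eq_sym jk0.
  pose Z := \int[@uniform_sphere R n]_(w in @sphere R n) expR (kappa * dot w om).
  have Cf k : sphere_Ck k f.
    apply: sphere_Ck_congr (sphere_CkM (@sphere_Ck_cst R n k (rho / Z)) (sphere_Ck_exp_dot k kappa om)).
    by move=> w /fE ->; rewrite /von_mises -/Z; ring.
  split=> // w ws; apply/eqP; rewrite flux_eq0//.
  rewrite (@sphere_grad_congr _ _ _ (fun=> rho / Z))//.
    apply/eqP/rowP => i; rewrite !mxE; exact: derive_cst.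
  move=> u us; rewrite /gauge fE// /von_mises -/Z kE -!dotZr vE expRN.
  have := expR_gt0 (dot u (kappa *: om)); move=> E0; field.
  by rewrite !gt_eqF// (von_mises_mass_gt0 Os).
move=> stmt_i stmt_ii stmt_iii.
have i_flux : stmt_i <-> sphere_Ck 2 f /\ forall w, sphere w -> flux kappa0 v f w = 0.
  by split=> -[Cf]; move/(Q0_flux0 nu tau_gt0 Cf).
have ii_flux : stmt_ii <-> sphere_Ck 1 f /\ forall w, sphere w -> flux kappa0 v f w = 0.
  by split=> -[Cf]; move/(dissipation0 nu tau_gt0 f_ge0 Cf).
have ii_iii : stmt_ii <-> stmt_iii.
  split=> [/ii_flux[Cf]|/iii_flux[Cf A0]]; first exact: flux_iii.
  by apply/ii_flux; split=> //; exact: sphere_CkW.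
(* From (ii) to (i) the missing derivative comes from the explicit form (iii). *)
split=> //; split=> [/i_flux[Cf A0]|/ii_iii/iii_flux/i_flux//].
by apply/ii_flux; split=> //; exact: sphere_CkW.
Qed.
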